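(* A minimal surface $\mathcal{S}$ in $\mathrm{Nil}$ (that is, a surface with mean curvature $H=0$) in some neighborhood of a non-umbilic point corresponds to a solution $v$ of the system $$ \begin{cases} \Delta v+8\sinh 2v=0,\\ \operatorname{Re}(e^{v})=0. \end{cases} $$ Here the correspondence is given by $e^{v}=U$, i.e. $v$ is a logarithm of the potential $U$ of the Dirac operator in the Weierstrass representation of $\mathcal{S}$ with respect to a conformal parameter $z=x+iy$ chosen near the point so that $B=\frac{2H+i}{2H-i}$, which equals $-1$ for $H=0$.
   Context: $\mathrm{Nil}$ is the three-dimensional Heisenberg group of real matrices $$\begin{pmatrix}1&x_1&x_3\\0&1&x_2\\0&0&1\end{pmatrix}$$ with matrix multiplication and the left-invariant metric $ds^2=dx_1^2+dx_2^2+(dx_3-x_1dx_2)^2$. Let $e_1=\partial/\partial x_1$, $e_2=\partial/\partial x_2$, $e_3=\partial/\partial x_3$ be the orthonormal basis of its Lie algebra at the identity. A surface $\mathcal{S}$ in $\mathrm{Nil}$ is represented locally as a conformal mapping $f:\Sigma\to\mathrm{Nil}$ from an open domain $\Sigma\subset\mathbb{C}$; the coordinate $z=x+iy\in\Sigma$ is a conformal parameter on $\mathcal{S}$. Write $\partial=\frac{\partial}{\partial z}=\frac12(\partial_x-i\partial_y)$, $\overline{\partial}=\frac{\partial}{\partial\overline z}=\frac12(\partial_x+i\partial_y)$, $\Delta=\partial_x^2+\partial_y^2=4\partial\overline{\partial}$. Weierstrass representation: the surface is obtained by solving $$f^{-1}\frac{\partial f}{\partial z}=\frac{i}{2}\big(\overline{\psi}_2^2+\psi_1^2\big)e_1+\frac12\big(\overline{\psi}_2^2-\psi_1^2\big)e_2+\psi_1\overline{\psi_2}\,e_3,$$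 where the complex-valued functions $\psi_1(z),\psi_2(z)$ satisfy the Dirac equation $\partial\psi_2+U\psi_1=0$, $-\overline{\partial}\psi_1+U\psi_2=0$ with the complex-valued potential $$U=\frac{H}{2}\big(|\psi_1|^2+|\psi_2|^2\big)+\frac{i}{4}\big(|\psi_2|^2-|\psi_1|^2\big),$$ and $H$ is the mean curvature of $\mathcal{S}$. A logarithm of $U$ is denoted by $v$, so $e^{v}=U$. Set $$\widetilde A=\overline{\psi_2}\,\partial\psi_1-\psi_1\,\partial\overline{\psi_2}+\frac{2Hi}{2H+i}\psi_1^2\,\overline{\psi}_2^2,\qquad B=\frac14(2H+i)\widetilde A.$$ The quadratic differential $B\,dz^2$ is called the Abresch–Rosenberg quadratic differential; it is holomorphic on constant mean curvature surfaces in $\mathrm{Nil}$. A point of the surface is called umbilic if $\widetilde A=0$ at that point, and non-umbilic otherwise. In some neighborhood of a non-umbilic point of a constant mean curvature surface the conformal parameter $z$ can be chosen so that $B=\frac{2H+i}{2H-i}$.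
   Formalization: The logarithm v exists near the non-umbilic point only under the added assumption that U does not vanish there (the tangent plane is not vertical); U can vanish at non-umbilic points of a minimal surface, and then no v with e^v = U exists. *)

(* Defs.v *)
(* Stdlib reals with Coquelicot. *)
From Stdlib Require Import Reals Lra Lia.
From Coquelicot Require Import Coquelicot.
Open Scope R_scope.

Definition pdx (g : C -> R) (z : C) : R :=
  Derive (fun t => g (t, snd z)) (fst z).
Definition pdy (g : C -> R) (z : C) : R :=
  Derive (fun t => g (fst z, t)) (snd z).

(* [Derive] is total, so the existence of the partial derivatives is required
   at every order. *)
Fixpoint Ck (n : nat) (S : C -> Prop) (g : C -> R) : Prop :=
  match n with
  | O => forall z, S z -> continuous g z
  | Datatypes.S m =>
      (forall z, S z ->
         ex_derive (fun t => g (t, snd z)) (fst z) /\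
         ex_derive (fun t => g (fst z, t)) (snd z))
      /\ Ck m S (pdx g) /\ Ck m S (pdy g)
  end.

Definition smooth (S : C -> Prop) (g : C -> R) : Prop := forall n, Ck n S g.

Definition smoothC (S : C -> Prop) (g : C -> C) : Prop :=
  smooth S (fun w => Re (g w)) /\ smooth S (fun w => Im (g w)).

Definition cdx (g : C -> C) (z : C) : C :=
  (pdx (fun w => Re (g w)) z, pdx (fun w => Im (g w)) z).
Definition cdy (g : C -> C) (z : C) : C :=
  (pdy (fun w => Re (g w)) z, pdy (fun w => Im (g w)) z).

Definition dz (g : C -> C) (z : C) : C := (/ 2 * (cdx g z - Ci * cdy g z))%C.
Definition dzbar (g : C -> C) (z : C) : C := (/ 2 * (cdx g z + Ci * cdy g z))%C.
Definition laplacian (g : C -> C) (z : C) : C :=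
  (cdx (cdx g) z + cdy (cdy g) z)%C.

Definition cexp (z : C) : C := (exp (Re z) * cos (Im z), exp (Re z) * sin (Im z)).
Definition csinh (z : C) : C := ((cexp z - cexp (- z)) / 2)%C.

(* [mkNil x1 x2 x3] stands for the upper unitriangular matrix [nil_matrix]. *)
Record Nil := mkNil { n1 : R; n2 : R; n3 : R }.

Definition nil_mul (p q : Nil) : Nil :=
  mkNil (n1 p + n1 q) (n2 p + n2 q) (n3 p + n3 q + n1 p * n2 q).
Definition nil_inv (p : Nil) : Nil :=
  mkNil (- n1 p) (- n2 p) (- n3 p + n1 p * n2 p).

Definition nil_matrix (p : Nil) : matrix 3 3 :=
  mk_matrix 3 3 (fun i j => match i, j return R with
    | 0, 1 => n1 p | 1, 2 => n2 p | 0, 2 => n3 p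
    | 0, 0 | 1, 1 | 2, 2 => 1%R
    | _, _ => 0%R
    end)%nat.

Lemma nil_matrix_mul (p q : Nil) :
  nil_matrix (nil_mul p q) = Mmult (nil_matrix p) (nil_matrix q).
Proof.
apply mk_matrix_ext; intros i j Hi Hj; cbv [Nat.pred]; rewrite !sum_Sn, sum_O.
destruct i as [|[|[|i]]]; try (exfalso; lia);
destruct j as [|[|[|j]]]; try (exfalso; lia);
unfold plus, mult, coeff_mat; simpl; unfold plus, mult; simpl; ring.
Qed.

Lemma nil_mul_inv (p : Nil) : nil_mul (nil_inv p) p = mkNil 0 0 0.
Proof. unfold nil_mul, nil_inv; simpl; f_equal; ring. Qed.

(* Triples are used both for coordinate vectors and, in the basis e1, e2, e3,
   for elements of the Lie algebra. *)
Definition V3 : Type := (R * R * R)%type.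
Definition v1 (u : V3) : R := fst (fst u).
Definition v2 (u : V3) : R := snd (fst u).
Definition v3 (u : V3) : R := snd u.

(* ds^2 = dx1^2 + dx2^2 + (dx3 - x1 dx2)^2 at the point p *)
Definition nil_metric (p : Nil) (u w : V3) : R :=
  v1 u * v1 w + v2 u * v2 w + (v3 u - n1 p * v2 u) * (v3 w - n1 p * v2 w).

Definition dot (u w : V3) : R := v1 u * v1 w + v2 u * v2 w + v3 u * v3 w.
Definition cross (u w : V3) : V3 :=
  (v2 u * v3 w - v3 u * v2 w, v3 u * v1 w - v1 u * v3 w, v1 u * v2 w - v2 u * v1 w).

(* Commutator of the strictly upper triangular matrices: [e1,e2] = e3, and e3
   is central. *)
Definition bracket (u w : V3) : V3 := (0, 0, v1 u * v2 w - v2 u * v1 w).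

(* Levi-Civita connection of the left-invariant metric, for left-invariant
   vector fields, given by the Koszul formula. *)
Definition koszul (u w t : V3) : R :=
  (dot (bracket u w) t - dot (bracket w t) u + dot (bracket t u) w) / 2.
Definition nabla (u w : V3) : V3 :=
  (koszul u w (1, 0, 0), koszul u w (0, 1, 0), koszul u w (0, 0, 1)).

Definition pdx3 (g : C -> V3) (z : C) : V3 :=
  (pdx (fun w => v1 (g w)) z, pdx (fun w => v2 (g w)) z, pdx (fun w => v3 (g w)) z).
Definition pdy3 (g : C -> V3) (z : C) : V3 :=
  (pdy (fun w => v1 (g w)) z, pdy (fun w => v2 (g w)) z, pdy (fun w => v3 (g w)) z).

Definition coords (p : Nil) : V3 := (n1 p, n2 p, n3 p).

(* f^{-1} f_x and f^{-1} f_y: the derivative at w = z of f(z)^{-1} f(w), a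
   tangent vector at the identity. *)
Definition mcx (f : C -> Nil) (z : C) : V3 :=
  pdx3 (fun w => coords (nil_mul (nil_inv (f z)) (f w))) z.
Definition mcy (f : C -> Nil) (z : C) : V3 :=
  pdy3 (fun w => coords (nil_mul (nil_inv (f z)) (f w))) z.

(* The components in e1, e2, e3 of f^{-1} df/dz. *)
Definition mcz (f : C -> Nil) (z : C) : C * C * C :=
  let c a b := (/ 2 * (RtoC a - Ci * RtoC b))%C in
  let X := mcx f z in let Y := mcy f z in
  (c (v1 X) (v1 Y), c (v2 X) (v2 Y), c (v3 X) (v3 Y)).

Definition smoothNil (S : C -> Prop) (f : C -> Nil) : Prop :=
  smooth S (fun w => n1 (f w)) /\ smooth S (fun w => n2 (f w)) /\
  smooth S (fun w => n3 (f w)).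

Definition conformal (S : C -> Prop) (f : C -> Nil) : Prop :=
  forall z, S z ->
    let X := pdx3 (fun w => coords (f w)) z in
    let Y := pdy3 (fun w => coords (f w)) z in
    nil_metric (f z) X X = nil_metric (f z) Y Y /\
    nil_metric (f z) X Y = 0 /\
    0 < nil_metric (f z) X X.

(* Everything is left-translated to the identity, where e1, e2, e3 is
   orthonormal; the normal is positively oriented, and the mean curvature is
   half the trace of the second fundamental form. *)
Definition normal (f : C -> Nil) (z : C) : V3 :=
  let n := cross (mcx f z) (mcy f z) in
  let l := sqrt (dot n n) in
  (v1 n / l, v2 n / l, v3 n / l).

Definition mean_curvature (f : C -> Nil) (z : C) : R :=
  let X := mcx f z in let Y := mcy f z in let N := normal f z in
  let E := dot X X in let F := dot X Y in let G := dot Y Y in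
  let h11 := dot (pdx3 (mcx f) z) N + dot (nabla X X) N in
  let h12 := dot (pdx3 (mcy f) z) N + dot (nabla X Y) N in
  let h22 := dot (pdy3 (mcy f) z) N + dot (nabla Y Y) N in
  (E * h22 - 2 * F * h12 + G * h11) / (2 * (E * G - F ^ 2)).

Definition minimal (S : C -> Prop) (f : C -> Nil) : Prop :=
  forall z, S z -> mean_curvature f z = 0.

Definition potential (f : C -> Nil) (psi1 psi2 : C -> C) (z : C) : C :=
  let a := Cmod (psi1 z) ^ 2 in
  let b := Cmod (psi2 z) ^ 2 in
  (RtoC (mean_curvature f z / 2 * (a + b)) + Ci / 4 * RtoC (b - a))%C.

Record weierstrass (S : C -> Prop) (f : C -> Nil) (psi1 psi2 : C -> C) : Prop :=
  mk_weierstrass {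
    w_smooth : smoothNil S f;
    w_smooth1 : smoothC S psi1;
    w_smooth2 : smoothC S psi2;
    w_conformal : conformal S f;
    w_repr : forall z, S z ->
      let a := psi1 z in let b := Cconj (psi2 z) in
      mcz f z = (Ci / 2 * (b * b + a * a), / 2 * (b * b - a * a), a * b)%C;
    w_dirac1 : forall z, S z ->
      (dz psi2 z + potential f psi1 psi2 z * psi1 z)%C = 0;
    w_dirac2 : forall z, S z ->
      (- dzbar psi1 z + potential f psi1 psi2 z * psi2 z)%C = 0
  }.

Definition Atilde (f : C -> Nil) (psi1 psi2 : C -> C) (z : C) : C :=
  let H := RtoC (mean_curvature f z) in
  let a := psi1 z in let b := Cconj (psi2 z) in
  (b * dz psi1 z - a * dz (fun w => Cconj (psi2 w)) z
   + 2 * H * Ci / (2 * H + Ci) * (a * a) * (b * b))%C.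

(* Coefficient of the Abresch-Rosenberg differential B dz^2. *)
Definition ARcoef (f : C -> Nil) (psi1 psi2 : C -> C) (z : C) : C :=
  let H := RtoC (mean_curvature f z) in
  (/ 4 * (2 * H + Ci) * Atilde f psi1 psi2 z)%C.

Definition umbilic (f : C -> Nil) (psi1 psi2 : C -> C) (z : C) : Prop :=
  Atilde f psi1 psi2 z = 0.

(* z = chi w expresses the parameter z of a neighbourhood of z0 through a new
   conformal parameter w ranging over S'. *)
Record conformal_change (S S' : C -> Prop) (chi : C -> C) (z0 : C) : Prop :=
  mk_conformal_change {
    cc_open : open S';
    cc_maps : forall w, S' w -> S (chi w);
    cc_smooth : smoothC S' chi;
    cc_holo : forall w, S' w -> dzbar chi w = 0;
    cc_immersion : forall w, S' w -> dz chi w <> 0;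
    cc_inj : forall w w', S' w -> S' w' -> chi w = chi w' -> w = w';
    cc_point : exists w, S' w /\ chi w = z0
  }.

(* In the new parameter the surface is f o chi, with spinors phi1, phi2, and
   B = (2H+i)/(2H-i). *)
Record normalized_parameter (S : C -> Prop) (f : C -> Nil) (z0 : C)
    (S' : C -> Prop) (chi phi1 phi2 : C -> C) : Prop :=
  mk_normalized_parameter {
    np_change : conformal_change S S' chi z0;
    np_weierstrass : weierstrass S' (fun w => f (chi w)) phi1 phi2;
    np_B : forall w, S' w ->
      let H := RtoC (mean_curvature (fun w => f (chi w)) w) in
      ARcoef (fun w => f (chi w)) phi1 phi2 w
      = ((2 * H + Ci) / (2 * H - Ci))%C
  }.

Definition continuous_log (V : C -> Prop) (v U : C -> C) : Prop :=
  forall w, V w -> continuous v w /\ cexp (v w) = U w.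

Definition solves_system (V : C -> Prop) (v : C -> C) : Prop :=
  smoothC V v /\
  forall w, V w ->
    (laplacian v w + 8 * csinh (2 * v w))%C = 0 /\ Re (cexp (v w)) = 0.

(* Main.v *)
Require Import Defs.
From Stdlib Require Import Reals Lra Lia Psatz ClassicalEpsilon.
From Coquelicot Require Import Coquelicot.

(** Put a = psi1, b = conj psi2. When H = 0 the potential is the imaginary
    function U = (i/4)(|b|^2 - |a|^2), so conj U = - U and the Dirac equation
    takes the symmetric form dzbar a = U conj b, dzbar b = U conj a.  The
    quantity A = b dz a - a dz b is then what remains of Atilde, and everything
    follows from differentiating these relations:
    - dzbar A = 0 ([wronskian_holomorphic]): the terms with the derivative of U
      cancel the others because dz U = (i/4)(conj b dz b - conj a dz a);
    - U dzbar dz U - dz U dzbar U = |A|^2 / 16 - U^4 ([potential_equation]):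
      the first-order terms combine by the indefinite form of Lagrange's
      identity for the vectors (a, b) and (dz a, dz b).
    For U = exp v the left side of the second relation is U^2 (Laplacian v) / 4.
    The normalization B = -1 says A = 4i, so the relation becomes
    Laplacian v = 4 (U^-2 - U^2) = - 8 sinh 2v, while Re U = 0 holds because
    H = 0.  A continuous logarithm v of U is automatically smooth: Re v is
    ln |Im U|, and Im v is continuous with values in pi/2 + pi Z, hence locally
    constant ([log_solves]).

    These relations are needed for the surface in a new parameter, whose
    potential involves its own mean curvature; that mean curvature vanishes
    because it is invariant under holomorphic changes of parameter
    ([mean_curvature_comp]).

    For the existence of the normalized parameter, write z = chi(w).  The
    spinors transform by a holomorphic square root l of chi', with
    a -> l a(chi), b -> l b(chi), hence A -> chi'^2 A(chi)
    ([weierstrass_reparam], [wronskian_reparam]).  So chi' = 1 / t(chi) is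
    wanted, where t^2 = A / (4i), and l = 1 / s(chi), where s^2 = t.  Near a
    point with A <> 0 the roots t and s exist and are holomorphic
    ([local_holomorphic_sqrt]); t has a primitive F ([holomorphic_primitive]),
    and chi is the local inverse of F ([holomorphic_local_inverse]), which is
    smooth because it solves chi' = 1 / t(chi) ([holomorphic_ode_smooth]). *)

(** * Partial derivatives and the classes Ck *)

Definition is_pdx (g : C -> R) (z : C) (l : R) : Prop :=
  is_derive (fun t => g (t, snd z)) (fst z) l.
Definition is_pdy (g : C -> R) (z : C) (l : R) : Prop :=
  is_derive (fun t => g (fst z, t)) (snd z) l.

Lemma is_pdx_unique g z l : is_pdx g z l -> pdx g z = l.
Proof. apply is_derive_unique. Qed.

Lemma is_pdy_unique g z l : is_pdy g z l -> pdy g z = l.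
Proof. apply is_derive_unique. Qed.

Lemma open_locally_2d (D : C -> Prop) z :
  open D -> D z -> locally_2d (fun u v => D (u, v)) (fst z) (snd z).
Proof.
intros HD Hz; apply locally_2d_locally; destruct z as [x y].
apply filter_imp with (2 := HD (x, y) Hz); now intros [u v].
Qed.

Lemma open_locally_x (D : C -> Prop) z :
  open D -> D z -> locally (fst z) (fun t => D (t, snd z)).
Proof.
intros HD Hz.
exact (locally_2d_1d_const_y _ _ _ (open_locally_2d D z HD Hz)).
Qed.

Lemma open_locally_y (D : C -> Prop) z :
  open D -> D z -> locally (snd z) (fun t => D (fst z, t)).
Proof.
intros HD Hz.
exact (locally_2d_1d_const_x _ _ _ (open_locally_2d D z HD Hz)).
Qed.

Lemma open_positive (D : C -> Prop) (g : C -> R) :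
  open D -> (forall w, D w -> continuous g w) -> open (fun w => D w /\ 0 < g w).
Proof.
intros HD Hg w [Hw Hp]; apply filter_and; [now apply HD|].
apply (Hg w Hw (fun x => 0 < x)); now apply open_gt.
Qed.

Lemma is_pdx_ext (D : C -> Prop) g h z l :
  open D -> D z -> (forall w, D w -> g w = h w) -> is_pdx g z l -> is_pdx h z l.
Proof.
intros HD Hz E; apply is_derive_ext_loc.
apply filter_imp with (2 := open_locally_x D z HD Hz); intros t Ht; now apply E.
Qed.

Lemma is_pdy_ext (D : C -> Prop) g h z l :
  open D -> D z -> (forall w, D w -> g w = h w) -> is_pdy g z l -> is_pdy h z l.
Proof.
intros HD Hz E; apply is_derive_ext_loc.
apply filter_imp with (2 := open_locally_y D z HD Hz); intros t Ht; now apply E.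
Qed.

Lemma pdx_ext (D : C -> Prop) g h z :
  open D -> D z -> (forall w, D w -> g w = h w) -> pdx g z = pdx h z.
Proof.
intros HD Hz E; apply Derive_ext_loc.
apply filter_imp with (2 := open_locally_x D z HD Hz); intros t Ht; now apply E.
Qed.

Lemma pdy_ext (D : C -> Prop) g h z :
  open D -> D z -> (forall w, D w -> g w = h w) -> pdy g z = pdy h z.
Proof.
intros HD Hz E; apply Derive_ext_loc.
apply filter_imp with (2 := open_locally_y D z HD Hz); intros t Ht; now apply E.
Qed.

(** The partial derivatives are total operators applied to functions on the
    whole plane, so replacing a function by one that agrees with it only on an
    open set needs this lemma and the two before it. *)
Lemma Ck_ext n : forall (D : C -> Prop) g h,
  open D -> (forall w, D w -> g w = h w) -> Ck n D g -> Ck n D h.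
Proof.
induction n as [|n IH]; intros D g h HD E.
- intros Hg z Hz; apply continuous_ext_loc with g; [|now apply Hg].
  apply filter_imp with (2 := HD z Hz); intros w Hw; now apply E.
- intros [H1 [H2 H3]]; split; [|split].
  + intros z Hz; destruct (H1 z Hz) as [[l Hl] [m Hm]]; split.
    * exists l; exact (is_pdx_ext D g h z l HD Hz E Hl).
    * exists m; exact (is_pdy_ext D g h z m HD Hz E Hm).
  + apply IH with (pdx g); auto; intros; now apply pdx_ext with D.
  + apply IH with (pdy g); auto; intros; now apply pdy_ext with D.
Qed.

Lemma Ck_S_is_pdx n D g z : Ck (S n) D g -> D z -> is_pdx g z (pdx g z).
Proof. intros [H _] Hz; apply Derive_correct, H, Hz. Qed.

Lemma Ck_S_is_pdy n D g z : Ck (S n) D g -> D z -> is_pdy g z (pdy g z).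
Proof. intros [H _] Hz; apply Derive_correct, H, Hz. Qed.

(** Avoids the total operators: it suffices to exhibit any two functions that
    are the partial derivatives on the open set. The closure properties below
    all go by induction through it. *)
Lemma Ck_S_intro n (D : C -> Prop) g gx gy :
  open D -> (forall z, D z -> is_pdx g z (gx z)) ->
  (forall z, D z -> is_pdy g z (gy z)) ->
  Ck n D gx -> Ck n D gy -> Ck (S n) D g.
Proof.
intros HD Hx Hy Cx Cy; split; [|split].
- intros z Hz; split; [exists (gx z); now apply Hx | exists (gy z); now apply Hy].
- apply Ck_ext with gx; auto; intros; symmetry; now apply is_pdx_unique, Hx.
- apply Ck_ext with gy; auto; intros; symmetry; now apply is_pdy_unique, Hy.
Qed.

Lemma Ck_subset n : forall (D D' : C -> Prop) g,
  (forall w, D' w -> D w) -> Ck n D g -> Ck n D' g.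
Proof.
induction n as [|n IH]; intros D D' g E.
- intros H z Hz; apply H, E, Hz.
- intros [H1 [H2 H3]]; split; [|split].
  + intros z Hz; apply H1, E, Hz.
  + now apply IH with D.
  + now apply IH with D.
Qed.

Definition has_gradient (g : C -> R) (z : C) (p q : R) : Prop :=
  differentiable_pt_lim (fun u v => g (u, v)) (fst z) (snd z) p q.

Lemma has_gradient_is_pdx g z p q : has_gradient g z p q -> is_pdx g z p.
Proof.
intros H; destruct z as [x y]; unfold has_gradient, is_pdx in *; simpl in *.
apply is_derive_Reals.
replace p with (p * 1 + q * 0) by ring.
apply (derivable_pt_lim_comp_2d (fun u v => g (u, v)) (fun t => t) (fun _ => y)); auto.
- apply derivable_pt_lim_id.
- apply derivable_pt_lim_const.
Qed.

Lemma has_gradient_is_pdy g z p q : has_gradient g z p q -> is_pdy g z q.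
Proof.
intros H; destruct z as [x y]; unfold has_gradient, is_pdy in *; simpl in *.
apply is_derive_Reals.
replace q with (p * 0 + q * 1) by ring.
apply (derivable_pt_lim_comp_2d (fun u v => g (u, v)) (fun _ => x) (fun t => t)); auto.
- apply derivable_pt_lim_const.
- apply derivable_pt_lim_id.
Qed.

Lemma continuous_continuity_2d (g : C -> R) (z : C) :
  continuous g z <-> continuity_2d_pt (fun u v => g (u, v)) (fst z) (snd z).
Proof.
rewrite continuity_2d_pt_filterlim; destruct z as [x y]; simpl.
split; apply filterlim_ext; now intros [u v].
Qed.

Lemma has_gradient_continuous g z p q : has_gradient g z p q -> continuous g z.
Proof.
intros H; apply continuous_continuity_2d.
apply differentiable_continuity_pt; now exists p, q.
Qed.

(** Continuous partial derivatives imply total differentiability, which the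
    chain rule and even the continuity of a Ck function depend on. *)
Lemma Ck1_has_gradient (D : C -> Prop) g z :
  open D -> D z -> Ck 1 D g -> has_gradient g z (pdx g z) (pdy g z).
Proof.
intros HD Hz [H1 [H2 H3]].
apply filterdiff_differentiable_pt_lim.
pose proof (is_derive_filterdiff (fun u v => g (u, v)) (fst z) (snd z)
  (fun u v => pdx g (u, v)) (pdy g z)) as K.
destruct z as [x y]; apply K; clear K.
- apply filter_imp with (2 := HD (x, y) Hz); intros [u v] Huv; simpl.
  now apply Derive_correct, (H1 (u, v)).
- now apply Derive_correct, (H1 (x, y)).
- apply continuous_ext with (pdx g); [now intros [u v]|]; now apply H2.
Qed.

(** Only the first step has content: continuity comes from total
    differentiability. *)
Lemma Ck_pred n : forall (D : C -> Prop) g, open D -> Ck (S n) D g -> Ck n D g.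
Proof.
induction n as [|n IH]; intros D g HD H.
- intros z Hz; eapply has_gradient_continuous, Ck1_has_gradient; eauto.
- destruct H as [H1 [H2 H3]]; split; [exact H1|]; split; apply IH; auto.
Qed.

Lemma Ck_S_has_gradient n (D : C -> Prop) g z :
  open D -> D z -> Ck (S n) D g -> has_gradient g z (pdx g z) (pdy g z).
Proof.
intros HD Hz; induction n as [|n IH]; intros Hg.
- now apply Ck1_has_gradient with D.
- apply IH, Ck_pred; auto.
Qed.

Lemma Ck_const n : forall (D : C -> Prop) c, open D -> Ck n D (fun _ => c).
Proof.
induction n as [|n IH]; intros D c HD.
- intros z _; apply continuous_const.
- apply Ck_S_intro with (gx := fun _ => 0) (gy := fun _ => 0); auto;
  intros z _; [apply (is_derive_const c (fst z)) | apply (is_derive_const c (snd z))].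
Qed.

Lemma Ck_plus n : forall (D : C -> Prop) g h,
  open D -> Ck n D g -> Ck n D h -> Ck n D (fun w => g w + h w).
Proof.
induction n as [|n IH]; intros D g h HD Hg Hh.
- intros z Hz; apply (continuous_plus g h); auto.
- apply Ck_S_intro with (fun w => pdx g w + pdx h w) (fun w => pdy g w + pdy h w);
    auto; try (apply IH; auto; apply Hg || apply Hh); intros z Hz.
  + apply (is_derive_plus (fun t => g (t, snd z)) (fun t => h (t, snd z)));
      eapply Ck_S_is_pdx; eauto.
  + apply (is_derive_plus (fun t => g (fst z, t)) (fun t => h (fst z, t)));
      eapply Ck_S_is_pdy; eauto.
Qed.

Lemma Ck_mult n : forall (D : C -> Prop) g h,
  open D -> Ck n D g -> Ck n D h -> Ck n D (fun w => g w * h w).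
Proof.
induction n as [|n IH]; intros D g h HD Hg Hh.
- intros z Hz; apply (continuous_mult g h); auto.
- assert (Cg := Ck_pred _ _ _ HD Hg); assert (Ch := Ck_pred _ _ _ HD Hh).
  apply Ck_S_intro with (fun w => pdx g w * h w + g w * pdx h w)
    (fun w => pdy g w * h w + g w * pdy h w);
    auto; try (apply Ck_plus; auto; apply IH; auto; apply Hg || apply Hh);
    intros z Hz.
  + pose proof (is_derive_mult (fun t => g (t, snd z)) (fun t => h (t, snd z)) (fst z)
     _ _ (Ck_S_is_pdx _ _ _ _ Hg Hz) (Ck_S_is_pdx _ _ _ _ Hh Hz) Rmult_comm) as K.
    destruct z as [x y]; exact K.
  + pose proof (is_derive_mult (fun t => g (fst z, t)) (fun t => h (fst z, t)) (snd z)
     _ _ (Ck_S_is_pdy _ _ _ _ Hg Hz) (Ck_S_is_pdy _ _ _ _ Hh Hz) Rmult_comm) as K.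
    destruct z as [x y]; exact K.
Qed.

Lemma Ck_opp n (D : C -> Prop) g : open D -> Ck n D g -> Ck n D (fun w => - g w).
Proof.
intros HD H; apply Ck_ext with (fun w => (-1) * g w); auto.
- intros; ring.
- apply Ck_mult; auto; now apply Ck_const.
Qed.

Lemma Ck_inv n : forall (D : C -> Prop) g,
  open D -> (forall w, D w -> g w <> 0) -> Ck n D g -> Ck n D (fun w => / g w).
Proof.
induction n as [|n IH]; intros D g HD N Hg.
- intros z Hz; apply continuous_comp with (g := Rinv); [now apply Hg|].
  now apply continuous_Rinv, N.
- assert (Ci' : Ck n D (fun w => / g w)) by (apply IH; auto; now apply Ck_pred).
  apply Ck_S_intro with (fun w => - (pdx g w * (/ g w * / g w)))
    (fun w => - (pdy g w * (/ g w * / g w)));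
    auto; try (apply Ck_opp; auto; apply Ck_mult; auto;
      [apply Hg | apply Ck_mult; auto]);
    intros z Hz; destruct z as [x y].
  + pose proof (is_derive_inv (fun t => g (t, y)) x _
      (Ck_S_is_pdx _ _ _ _ Hg Hz) (N _ Hz)) as K.
    replace (- (pdx g (x, y) * (/ g (x, y) * / g (x, y))))
      with (- pdx g (x, y) / g (x, y) ^ 2) by (field; now apply N).
    exact K.
  + pose proof (is_derive_inv (fun t => g (x, t)) y _
      (Ck_S_is_pdy _ _ _ _ Hg Hz) (N _ Hz)) as K.
    replace (- (pdy g (x, y) * (/ g (x, y) * / g (x, y))))
      with (- pdy g (x, y) / g (x, y) ^ 2) by (field; now apply N).
    exact K.
Qed.

(** The derivative of sqrt g is g' / (2 sqrt g), so the induction runs through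
    the inverse. *)
Lemma Ck_sqrt n : forall (D : C -> Prop) g,
  open D -> (forall w, D w -> 0 < g w) -> Ck n D g -> Ck n D (fun w => sqrt (g w)).
Proof.
induction n as [|n IH]; intros D g HD P Hg.
- intros z Hz; apply continuous_comp with (g := sqrt); [now apply Hg|].
  apply continuous_sqrt.
- assert (Q : forall w, D w -> 2 * sqrt (g w) <> 0).
  { intros w Hw; specialize (sqrt_lt_R0 _ (P w Hw)); lra. }
  assert (Ci' : Ck n D (fun w => / (2 * sqrt (g w)))).
  { apply Ck_inv; auto; apply Ck_mult; auto; [now apply Ck_const|].
    apply IH; auto; now apply Ck_pred. }
  apply Ck_S_intro with (fun w => pdx g w * / (2 * sqrt (g w)))
    (fun w => pdy g w * / (2 * sqrt (g w)));
    auto; try (apply Ck_mult; auto; apply Hg);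
    intros z Hz; destruct z as [x y].
  + exact (is_derive_sqrt (fun t => g (t, y)) x _
      (Ck_S_is_pdx _ _ _ _ Hg Hz) (P _ Hz)).
  + exact (is_derive_sqrt (fun t => g (x, t)) y _
      (Ck_S_is_pdy _ _ _ _ Hg Hz) (P _ Hz)).
Qed.

Lemma is_pdx_ln g z l : 0 < g z -> is_pdx g z l -> is_pdx (fun w => ln (g w)) z (l / g z).
Proof.
intros P H; destruct z as [x y].
exact (is_derive_comp ln (fun t => g (t, y)) x _ _ (is_derive_ln _ P) H).
Qed.

Lemma is_pdy_ln g z l : 0 < g z -> is_pdy g z l -> is_pdy (fun w => ln (g w)) z (l / g z).
Proof.
intros P H; destruct z as [x y].
exact (is_derive_comp ln (fun t => g (x, t)) y _ _ (is_derive_ln _ P) H).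
Qed.

Lemma Ck_ln n (D : C -> Prop) g :
  open D -> (forall w, D w -> 0 < g w) -> Ck (S n) D g -> Ck (S n) D (fun w => ln (g w)).
Proof.
intros HD P Hg.
assert (Ci' : Ck n D (fun w => / g w)).
{ apply Ck_inv; auto; [intros w Hw; specialize (P w Hw); lra | now apply Ck_pred]. }
apply Ck_S_intro with (fun w => pdx g w * / g w) (fun w => pdy g w * / g w);
  auto; try (apply Ck_mult; auto; apply Hg); intros z Hz.
- apply is_pdx_ln; auto; eapply Ck_S_is_pdx; eauto.
- apply is_pdy_ln; auto; eapply Ck_S_is_pdy; eauto.
Qed.

Lemma pair_eta (z : C) : (Re z, Im z) = z.
Proof. now destruct z. Qed.

Lemma is_pdx_comp g (chi : C -> C) z p q l m :
  has_gradient g (chi z) p q -> is_pdx (fun w => Re (chi w)) z l ->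
  is_pdx (fun w => Im (chi w)) z m ->
  is_pdx (fun w => g (chi w)) z (p * l + q * m).
Proof.
intros Hg Hl Hm; destruct z as [x y]; unfold is_pdx in *; simpl in *.
apply is_derive_ext with (fun t => g (Re (chi (t, y)), Im (chi (t, y)))).
{ intros; now rewrite pair_eta. }
apply is_derive_Reals.
apply (derivable_pt_lim_comp_2d (fun u v => g (u, v))); auto; now apply is_derive_Reals.
Qed.

Lemma is_pdy_comp g (chi : C -> C) z p q l m :
  has_gradient g (chi z) p q -> is_pdy (fun w => Re (chi w)) z l ->
  is_pdy (fun w => Im (chi w)) z m ->
  is_pdy (fun w => g (chi w)) z (p * l + q * m).
Proof.
intros Hg Hl Hm; destruct z as [x y]; unfold is_pdy in *; simpl in *.
apply is_derive_ext with (fun t => g (Re (chi (x, t)), Im (chi (x, t)))).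
{ intros; now rewrite pair_eta. }
apply is_derive_Reals.
apply (derivable_pt_lim_comp_2d (fun u v => g (u, v))); auto; now apply is_derive_Reals.
Qed.

Lemma continuous_C (chi : C -> C) z :
  continuous chi z <->
  continuous (fun w => Re (chi w)) z /\ continuous (fun w => Im (chi w)) z.
Proof.
split.
- intros H; split.
  + exact (continuous_comp chi fst z H (continuous_fst _ _)).
  + exact (continuous_comp chi snd z H (continuous_snd _ _)).
- intros [H1 H2].
  apply continuous_ext with (fun w => (Re (chi w), Im (chi w))).
  { intros; apply pair_eta. }
  intros P [eps HP].
  apply (filterlim_pair _ _ H1 H2).
  exists (ball (Re (chi z)) eps) (ball (Im (chi z)) eps); try apply locally_ball.
  intros u v Hu Hv; apply HP; now split.
Qed.

(** The chain rule expresses the partial derivatives of the composition by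
    compositions of one class lower. *)
Lemma Ck_comp n : forall (D D' : C -> Prop) g (chi : C -> C),
  open D -> open D' -> (forall w, D' w -> D (chi w)) -> Ck n D g ->
  Ck n D' (fun w => Re (chi w)) -> Ck n D' (fun w => Im (chi w)) ->
  Ck n D' (fun w => g (chi w)).
Proof.
induction n as [|n IH]; intros D D' g chi HD HD' M Hg Hr Hi.
- intros z Hz; apply continuous_comp; [|now apply Hg, M].
  apply continuous_C; split; auto.
- assert (Cr := Ck_pred _ _ _ HD' Hr); assert (Cim := Ck_pred _ _ _ HD' Hi).
  assert (G : forall z, D' z -> has_gradient g (chi z) (pdx g (chi z)) (pdy g (chi z))).
  { intros z Hz; apply Ck_S_has_gradient with n D; auto. }
  apply Ck_S_intro with
    (fun w => pdx g (chi w) * pdx (fun w => Re (chi w)) w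
              + pdy g (chi w) * pdx (fun w => Im (chi w)) w)
    (fun w => pdx g (chi w) * pdy (fun w => Re (chi w)) w
              + pdy g (chi w) * pdy (fun w => Im (chi w)) w); auto.
  + intros z Hz; apply is_pdx_comp; auto; eapply Ck_S_is_pdx; eauto.
  + intros z Hz; apply is_pdy_comp; auto; eapply Ck_S_is_pdy; eauto.
  + destruct Hg as [_ [Gx Gy]], Hr as [_ [Rx Ry]], Hi as [_ [Ix Iy]].
    apply Ck_plus; auto; apply Ck_mult; auto; now apply (IH D D').
  + destruct Hg as [_ [Gx Gy]], Hr as [_ [Rx Ry]], Hi as [_ [Ix Iy]].
    apply Ck_plus; auto; apply Ck_mult; auto; now apply (IH D D').
Qed.

(** * Smooth functions and Wirtinger derivatives *)

Lemma smooth_ext D g h :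
  open D -> (forall w, D w -> g w = h w) -> smooth D g -> smooth D h.
Proof. intros HD E H n; apply Ck_ext with g; auto. Qed.

Lemma smooth_subset (D D' : C -> Prop) g :
  (forall w, D' w -> D w) -> smooth D g -> smooth D' g.
Proof. intros E H n; apply Ck_subset with D; auto. Qed.

Lemma smooth_const (D : C -> Prop) c : open D -> smooth D (fun _ => c).
Proof. intros HD n; now apply Ck_const. Qed.

Lemma smooth_plus (D : C -> Prop) g h :
  open D -> smooth D g -> smooth D h -> smooth D (fun w => g w + h w).
Proof. intros HD Hg Hh n; now apply Ck_plus. Qed.

Lemma smooth_mult (D : C -> Prop) g h :
  open D -> smooth D g -> smooth D h -> smooth D (fun w => g w * h w).
Proof. intros HD Hg Hh n; now apply Ck_mult. Qed.

Lemma smooth_opp (D : C -> Prop) g : open D -> smooth D g -> smooth D (fun w => - g w).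
Proof. intros HD Hg n; now apply Ck_opp. Qed.

Lemma smooth_minus (D : C -> Prop) g h :
  open D -> smooth D g -> smooth D h -> smooth D (fun w => g w - h w).
Proof. intros HD Hg Hh; apply smooth_plus; auto; now apply smooth_opp. Qed.

Lemma smooth_inv (D : C -> Prop) g :
  open D -> (forall w, D w -> g w <> 0) -> smooth D g -> smooth D (fun w => / g w).
Proof. intros HD N Hg n; now apply Ck_inv. Qed.

Lemma smooth_sqrt (D : C -> Prop) g :
  open D -> (forall w, D w -> 0 < g w) -> smooth D g -> smooth D (fun w => sqrt (g w)).
Proof. intros HD N Hg n; now apply Ck_sqrt. Qed.

Lemma smooth_ln (D : C -> Prop) g :
  open D -> (forall w, D w -> 0 < g w) -> smooth D g -> smooth D (fun w => ln (g w)).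
Proof. intros HD N Hg n; apply Ck_pred; auto; apply Ck_ln; auto. Qed.

Lemma smooth_pdx D g : smooth D g -> smooth D (pdx g).
Proof. intros H n; apply (H (S n)). Qed.

Lemma smooth_pdy D g : smooth D g -> smooth D (pdy g).
Proof. intros H n; apply (H (S n)). Qed.

Lemma smooth_comp (D D' : C -> Prop) g (chi : C -> C) :
  open D -> open D' -> (forall w, D' w -> D (chi w)) -> smooth D g ->
  smoothC D' chi -> smooth D' (fun w => g (chi w)).
Proof. intros HD HD' M Hg [Hr Hi] n; now apply Ck_comp with D. Qed.

Lemma smooth_continuous D g z : smooth D g -> D z -> continuous g z.
Proof. intros H; apply (H O). Qed.

Lemma smooth_is_pdx (D : C -> Prop) g z : smooth D g -> D z -> is_pdx g z (pdx g z).
Proof. intros H; apply (Ck_S_is_pdx 0 D g z (H 1%nat)). Qed.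

Lemma smooth_is_pdy (D : C -> Prop) g z : smooth D g -> D z -> is_pdy g z (pdy g z).
Proof. intros H; apply (Ck_S_is_pdy 0 D g z (H 1%nat)). Qed.

Lemma smooth_has_gradient (D : C -> Prop) g z :
  open D -> smooth D g -> D z -> has_gradient g z (pdx g z) (pdy g z).
Proof. intros HD H Hz; now apply Ck1_has_gradient with D. Qed.

Lemma pdx_pdy_comm (D : C -> Prop) g z :
  open D -> smooth D g -> D z -> pdx (pdy g) z = pdy (pdx g) z.
Proof.
intros HD H Hz.
pose proof (Schwarz (fun u v => g (u, v)) (fst z) (snd z)) as K.
destruct z as [x y]; apply K; clear K.
- destruct (open_locally_2d D (x, y) HD Hz) as [d Hd]; exists d; intros u v Hu Hv.
  specialize (Hd u v Hu Hv); simpl in Hd.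
  repeat split.
  + exact (proj1 (proj1 (H 1%nat) (u, v) Hd)).
  + exact (proj2 (proj1 (H 1%nat) (u, v) Hd)).
  + exact (proj1 (proj1 (smooth_pdy _ _ H 1%nat) (u, v) Hd)).
  + exact (proj2 (proj1 (smooth_pdx _ _ H 1%nat) (u, v) Hd)).
- apply (continuous_continuity_2d (pdx (pdy g)) (x, y)).
  apply smooth_continuous with D; auto; now apply smooth_pdx, smooth_pdy.
- apply (continuous_continuity_2d (pdy (pdx g)) (x, y)).
  apply smooth_continuous with D; auto; now apply smooth_pdy, smooth_pdx.
Qed.

Lemma dz_pair g z :
  dz g z = ((pdx (fun w => Re (g w)) z + pdy (fun w => Im (g w)) z) / 2,
            (pdx (fun w => Im (g w)) z - pdy (fun w => Re (g w)) z) / 2).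
Proof. apply injective_projections; simpl; field. Qed.

Lemma dzbar_pair g z :
  dzbar g z = ((pdx (fun w => Re (g w)) z - pdy (fun w => Im (g w)) z) / 2,
               (pdx (fun w => Im (g w)) z + pdy (fun w => Re (g w)) z) / 2).
Proof. apply injective_projections; simpl; field. Qed.

(** The values p of dz g and q of dzbar g, recorded by the four real partial
    derivatives that they determine; unlike the values of dz and dzbar, this
    also asserts that the partial derivatives exist, so that the rules of
    calculus can be chained without side conditions. *)
Definition wirtinger (g : C -> C) (z p q : C) : Prop :=
  is_pdx (fun w => Re (g w)) z (Re p + Re q) /\
  is_pdx (fun w => Im (g w)) z (Im p + Im q) /\
  is_pdy (fun w => Re (g w)) z (Im q - Im p) /\
  is_pdy (fun w => Im (g w)) z (Re p - Re q).

Lemma wirtinger_dz g z p q : wirtinger g z p q -> dz g z = p.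
Proof.
intros [H1 [H2 [H3 H4]]]; rewrite dz_pair.
rewrite (is_pdx_unique _ _ _ H1), (is_pdx_unique _ _ _ H2),
  (is_pdy_unique _ _ _ H3), (is_pdy_unique _ _ _ H4).
apply injective_projections; simpl; unfold Re, Im; field.
Qed.

Lemma wirtinger_dzbar g z p q : wirtinger g z p q -> dzbar g z = q.
Proof.
intros [H1 [H2 [H3 H4]]]; rewrite dzbar_pair.
rewrite (is_pdx_unique _ _ _ H1), (is_pdx_unique _ _ _ H2),
  (is_pdy_unique _ _ _ H3), (is_pdy_unique _ _ _ H4).
apply injective_projections; simpl; unfold Re, Im; field.
Qed.

Lemma is_pdx_eq g z l m : is_pdx g z l -> l = m -> is_pdx g z m.
Proof. now intros H <-. Qed.

Lemma is_pdy_eq g z l m : is_pdy g z l -> l = m -> is_pdy g z m.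
Proof. now intros H <-. Qed.

Lemma wirtinger_smooth D g z :
  smoothC D g -> D z -> wirtinger g z (dz g z) (dzbar g z).
Proof.
intros [Hr Hi] Hz; rewrite dz_pair, dzbar_pair.
unfold wirtinger; simpl.
split; [|split; [|split]].
- eapply is_pdx_eq; [now apply (smooth_is_pdx D) | field].
- eapply is_pdx_eq; [now apply (smooth_is_pdx D) | field].
- eapply is_pdy_eq; [now apply (smooth_is_pdy D) | field].
- eapply is_pdy_eq; [now apply (smooth_is_pdy D) | field].
Qed.

Lemma wirtinger_eq g z p q p' q' :
  wirtinger g z p q -> p = p' -> q = q' -> wirtinger g z p' q'.
Proof. now intros H <- <-. Qed.

Lemma dz_ext (D : C -> Prop) g h z :
  open D -> D z -> (forall w, D w -> g w = h w) -> dz g z = dz h z.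
Proof.
intros HD Hz E; rewrite !dz_pair.
rewrite (pdx_ext D (fun w => Re (g w)) (fun w => Re (h w))),
 (pdx_ext D (fun w => Im (g w)) (fun w => Im (h w))),
 (pdy_ext D (fun w => Re (g w)) (fun w => Re (h w))),
 (pdy_ext D (fun w => Im (g w)) (fun w => Im (h w))); auto; intros; now rewrite E.
Qed.

Lemma dzbar_ext (D : C -> Prop) g h z :
  open D -> D z -> (forall w, D w -> g w = h w) -> dzbar g z = dzbar h z.
Proof.
intros HD Hz E; rewrite !dzbar_pair.
rewrite (pdx_ext D (fun w => Re (g w)) (fun w => Re (h w))),
 (pdx_ext D (fun w => Im (g w)) (fun w => Im (h w))),
 (pdy_ext D (fun w => Re (g w)) (fun w => Re (h w))),
 (pdy_ext D (fun w => Im (g w)) (fun w => Im (h w))); auto; intros; now rewrite E.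
Qed.

Lemma wirtinger_const c z : wirtinger (fun _ => c) z 0 0.
Proof.
unfold wirtinger; simpl; rewrite !Rplus_0_r, !Rminus_0_r.
split; [|split; [|split]].
- apply (is_derive_const (Re c) (fst z)).
- apply (is_derive_const (Im c) (fst z)).
- apply (is_derive_const (Re c) (snd z)).
- apply (is_derive_const (Im c) (snd z)).
Qed.

Lemma wirtinger_id z : wirtinger (fun w => w) z 1 0.
Proof.
split; [|split; [|split]]; simpl.
- eapply is_pdx_eq; [apply (is_derive_id (fst z)) | unfold one; simpl; ring].
- eapply is_pdx_eq; [apply (is_derive_const (snd z) (fst z)) | unfold zero; simpl; ring].
- eapply is_pdy_eq; [apply (is_derive_const (fst z) (snd z)) | unfold zero; simpl; ring].
- eapply is_pdy_eq; [apply (is_derive_id (snd z)) | unfold one; simpl; ring].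
Qed.

Lemma is_pdx_plus g h z l m :
  is_pdx g z l -> is_pdx h z m -> is_pdx (fun w => g w + h w) z (l + m).
Proof. apply (is_derive_plus (fun t => g (t, snd z)) (fun t => h (t, snd z))). Qed.

Lemma is_pdy_plus g h z l m :
  is_pdy g z l -> is_pdy h z m -> is_pdy (fun w => g w + h w) z (l + m).
Proof. apply (is_derive_plus (fun t => g (fst z, t)) (fun t => h (fst z, t))). Qed.

Lemma is_pdx_minus g h z l m :
  is_pdx g z l -> is_pdx h z m -> is_pdx (fun w => g w - h w) z (l - m).
Proof. apply (is_derive_minus (fun t => g (t, snd z)) (fun t => h (t, snd z))). Qed.

Lemma is_pdy_minus g h z l m :
  is_pdy g z l -> is_pdy h z m -> is_pdy (fun w => g w - h w) z (l - m).
Proof. apply (is_derive_minus (fun t => g (fst z, t)) (fun t => h (fst z, t))). Qed.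

Lemma is_pdx_mult g h z l m :
  is_pdx g z l -> is_pdx h z m -> is_pdx (fun w => g w * h w) z (l * h z + g z * m).
Proof.
intros Hg Hh; destruct z as [x y].
exact (is_derive_mult (fun t => g (t, y)) (fun t => h (t, y)) x l m Hg Hh Rmult_comm).
Qed.

Lemma is_pdy_mult g h z l m :
  is_pdy g z l -> is_pdy h z m -> is_pdy (fun w => g w * h w) z (l * h z + g z * m).
Proof.
intros Hg Hh; destruct z as [x y].
exact (is_derive_mult (fun t => g (x, t)) (fun t => h (x, t)) y l m Hg Hh Rmult_comm).
Qed.

Lemma wirtinger_plus g h z p q p' q' :
  wirtinger g z p q -> wirtinger h z p' q' ->
  wirtinger (fun w => (g w + h w)%C) z (p + p')%C (q + q')%C.
Proof.
intros [H1 [H2 [H3 H4]]] [K1 [K2 [K3 K4]]].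
split; [|split; [|split]].
- eapply is_pdx_eq; [apply (is_pdx_plus _ _ _ _ _ H1 K1) | unfold Re, Im; simpl; ring].
- eapply is_pdx_eq; [apply (is_pdx_plus _ _ _ _ _ H2 K2) | unfold Re, Im; simpl; ring].
- eapply is_pdy_eq; [apply (is_pdy_plus _ _ _ _ _ H3 K3) | unfold Re, Im; simpl; ring].
- eapply is_pdy_eq; [apply (is_pdy_plus _ _ _ _ _ H4 K4) | unfold Re, Im; simpl; ring].
Qed.

Lemma wirtinger_mult g h z p q p' q' :
  wirtinger g z p q -> wirtinger h z p' q' ->
  wirtinger (fun w => (g w * h w)%C) z (p * h z + g z * p')%C (q * h z + g z * q')%C.
Proof.
intros [H1 [H2 [H3 H4]]] [K1 [K2 [K3 K4]]].
split; [|split; [|split]].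
- eapply is_pdx_eq; [apply (is_pdx_minus _ _ _ _ _
    (is_pdx_mult _ _ _ _ _ H1 K1) (is_pdx_mult _ _ _ _ _ H2 K2)) |
    unfold Re, Im; simpl; ring].
- eapply is_pdx_eq; [apply (is_pdx_plus _ _ _ _ _
    (is_pdx_mult _ _ _ _ _ H1 K2) (is_pdx_mult _ _ _ _ _ H2 K1)) |
    unfold Re, Im; simpl; ring].
- eapply is_pdy_eq; [apply (is_pdy_minus _ _ _ _ _
    (is_pdy_mult _ _ _ _ _ H3 K3) (is_pdy_mult _ _ _ _ _ H4 K4)) |
    unfold Re, Im; simpl; ring].
- eapply is_pdy_eq; [apply (is_pdy_plus _ _ _ _ _
    (is_pdy_mult _ _ _ _ _ H3 K4) (is_pdy_mult _ _ _ _ _ H4 K3)) |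
    unfold Re, Im; simpl; ring].
Qed.

Lemma is_pdx_opp g z l : is_pdx g z l -> is_pdx (fun w => - g w) z (- l).
Proof. apply (is_derive_opp (fun t => g (t, snd z))). Qed.

Lemma is_pdy_opp g z l : is_pdy g z l -> is_pdy (fun w => - g w) z (- l).
Proof. apply (is_derive_opp (fun t => g (fst z, t))). Qed.

Lemma wirtinger_conj g z p q :
  wirtinger g z p q -> wirtinger (fun w => Cconj (g w)) z (Cconj q) (Cconj p).
Proof.
intros [H1 [H2 [H3 H4]]].
split; [|split; [|split]].
- eapply is_pdx_eq; [apply H1 | simpl; unfold Re, Im; ring].
- eapply is_pdx_eq; [apply (is_pdx_opp _ _ _ H2) | simpl; unfold Re, Im; ring].
- eapply is_pdy_eq; [apply H3 | simpl; unfold Re, Im; ring].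
- eapply is_pdy_eq; [apply (is_pdy_opp _ _ _ H4) | simpl; unfold Re, Im; ring].
Qed.

Lemma wirtinger_minus g h z p q p' q' :
  wirtinger g z p q -> wirtinger h z p' q' ->
  wirtinger (fun w => (g w - h w)%C) z (p - p')%C (q - q')%C.
Proof.
intros [H1 [H2 [H3 H4]]] [K1 [K2 [K3 K4]]].
split; [|split; [|split]].
- eapply is_pdx_eq; [apply (is_pdx_minus _ _ _ _ _ H1 K1) | unfold Re, Im; simpl; ring].
- eapply is_pdx_eq; [apply (is_pdx_minus _ _ _ _ _ H2 K2) | unfold Re, Im; simpl; ring].
- eapply is_pdy_eq; [apply (is_pdy_minus _ _ _ _ _ H3 K3) | unfold Re, Im; simpl; ring].
- eapply is_pdy_eq; [apply (is_pdy_minus _ _ _ _ _ H4 K4) | unfold Re, Im; simpl; ring].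
Qed.

(** Along a holomorphic inner function the two Wirtinger derivatives do not
    mix: dz g is multiplied by chi' and dzbar g by its conjugate. *)
Lemma wirtinger_comp_holo (D : C -> Prop) g chi z p :
  open D -> smoothC D g -> D (chi z) -> wirtinger chi z p 0 ->
  wirtinger (fun w => g (chi w)) z (dz g (chi z) * p)%C (dzbar g (chi z) * Cconj p)%C.
Proof.
intros HD Hg Hz [H1 [H2 [H3 H4]]].
pose proof (smooth_has_gradient D _ _ HD (proj1 Hg) Hz) as Gr.
pose proof (smooth_has_gradient D _ _ HD (proj2 Hg) Hz) as Gi.
rewrite dz_pair, dzbar_pair.
split; [|split; [|split]].
- eapply is_pdx_eq; [apply (is_pdx_comp _ _ _ _ _ _ _ Gr H1 H2) | simpl; unfold Re, Im; field].
- eapply is_pdx_eq; [apply (is_pdx_comp _ _ _ _ _ _ _ Gi H1 H2) | simpl; unfold Re, Im; field].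
- eapply is_pdy_eq; [apply (is_pdy_comp _ _ _ _ _ _ _ Gr H3 H4) | simpl; unfold Re, Im; field].
- eapply is_pdy_eq; [apply (is_pdy_comp _ _ _ _ _ _ _ Gi H3 H4) | simpl; unfold Re, Im; field].
Qed.

Definition holomorphic (D : C -> Prop) (g : C -> C) : Prop :=
  smoothC D g /\ forall z, D z -> dzbar g z = 0.

Lemma wirtinger_holomorphic D g z :
  holomorphic D g -> D z -> wirtinger g z (dz g z) 0.
Proof. intros [Hs Hh] Hz; rewrite <- (Hh z Hz); now apply wirtinger_smooth with D. Qed.

Lemma smoothC_ext D g h :
  open D -> (forall w, D w -> g w = h w) -> smoothC D g -> smoothC D h.
Proof.
intros HD E [H1 H2]; split.
- apply smooth_ext with (fun w => Re (g w)); auto; intros; now rewrite E.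
- apply smooth_ext with (fun w => Im (g w)); auto; intros; now rewrite E.
Qed.

Lemma smoothC_subset (D D' : C -> Prop) g :
  (forall w, D' w -> D w) -> smoothC D g -> smoothC D' g.
Proof. intros E [H1 H2]; split; eapply smooth_subset; eauto. Qed.

Lemma smoothC_const (D : C -> Prop) c : open D -> smoothC D (fun _ => c).
Proof. intros HD; split; now apply smooth_const. Qed.

Lemma smoothC_plus (D : C -> Prop) g h :
  open D -> smoothC D g -> smoothC D h -> smoothC D (fun w => (g w + h w)%C).
Proof. intros HD [] []; split; now apply smooth_plus. Qed.

Lemma smoothC_opp (D : C -> Prop) g :
  open D -> smoothC D g -> smoothC D (fun w => (- g w)%C).
Proof. intros HD []; split; now apply smooth_opp. Qed.

Lemma smoothC_minus (D : C -> Prop) g h :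
  open D -> smoothC D g -> smoothC D h -> smoothC D (fun w => (g w - h w)%C).
Proof. intros; apply smoothC_plus; auto; now apply smoothC_opp. Qed.

Lemma smoothC_mult (D : C -> Prop) g h :
  open D -> smoothC D g -> smoothC D h -> smoothC D (fun w => (g w * h w)%C).
Proof.
intros HD [] []; split.
- apply smooth_minus; auto; now apply smooth_mult.
- apply smooth_plus; auto; now apply smooth_mult.
Qed.

Lemma smoothC_conj (D : C -> Prop) g :
  open D -> smoothC D g -> smoothC D (fun w => Cconj (g w)).
Proof. intros HD []; split; auto; now apply smooth_opp. Qed.

Lemma C_neq_0_norm2 (c : C) : c <> 0 -> 0 < Re c ^ 2 + Im c ^ 2.
Proof.
intros H; destruct c as [x y]; simpl.
destruct (Req_dec x 0) as [->|Hx]; [|nra].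
destruct (Req_dec y 0) as [->|Hy]; [|nra].
now elim H.
Qed.

Lemma smoothC_inv (D : C -> Prop) (g : C -> C) :
  open D -> (forall w, D w -> g w <> 0) -> smoothC D g -> smoothC D (fun w => (/ g w)%C).
Proof.
intros HD N [Hr Hi].
assert (K : smooth D (fun w => / (Re (g w) ^ 2 + Im (g w) ^ 2))).
{ apply smooth_inv; auto.
  - intros w Hw; specialize (C_neq_0_norm2 _ (N w Hw)); lra.
  - apply smooth_plus; auto; simpl; repeat apply smooth_mult; auto; now apply smooth_const. }
split.
- now apply (smooth_mult D (fun w => Re (g w))).
- apply (smooth_mult D (fun w => - Im (g w))); auto; now apply smooth_opp.
Qed.

Lemma smoothC_comp (D D' : C -> Prop) g (chi : C -> C) :
  open D -> open D' -> (forall w, D' w -> D (chi w)) -> smoothC D g ->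
  smoothC D' chi -> smoothC D' (fun w => g (chi w)).
Proof.
intros HD HD' M [Hr Hi] Hc; split.
- exact (smooth_comp D D' (fun w => Re (g w)) chi HD HD' M Hr Hc).
- exact (smooth_comp D D' (fun w => Im (g w)) chi HD HD' M Hi Hc).
Qed.

Lemma smoothC_continuous D g z : smoothC D g -> D z -> continuous g z.
Proof.
intros [H1 H2] Hz; apply continuous_C; split; eapply smooth_continuous; eauto.
Qed.

Lemma smoothC_dz (D : C -> Prop) g : open D -> smoothC D g -> smoothC D (dz g).
Proof.
intros HD [Hr Hi].
apply smoothC_ext with (fun z =>
  ((pdx (fun w => Re (g w)) z + pdy (fun w => Im (g w)) z) / 2,
   (pdx (fun w => Im (g w)) z - pdy (fun w => Re (g w)) z) / 2)); auto.
{ intros; now rewrite dz_pair. }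
split; simpl; apply (smooth_mult D); auto using smooth_const.
- apply smooth_plus; auto using smooth_pdx, smooth_pdy.
- apply smooth_minus; auto using smooth_pdx, smooth_pdy.
Qed.

(** Expanding 4 dzbar dz leaves, besides the two pure second derivatives, i
    times the difference of the mixed ones, which vanishes by symmetry. *)
Lemma laplacian_dzbar_dz (D : C -> Prop) g z :
  open D -> smoothC D g -> D z -> (laplacian g z = 4 * dzbar (dz g) z)%C.
Proof.
intros HD Hg Hz.
assert (Gx : smoothC D (cdx g)) by (split; apply smooth_pdx; apply Hg).
assert (Gy : smoothC D (cdy g)) by (split; apply smooth_pdy; apply Hg).
pose proof (wirtinger_mult _ _ z _ _ _ _ (wirtinger_const (/ 2)%C z)
  (wirtinger_minus _ _ _ _ _ _ _ (wirtinger_smooth D _ z Gx Hz)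
    (wirtinger_mult _ _ z _ _ _ _ (wirtinger_const Ci z)
       (wirtinger_smooth D _ z Gy Hz)))) as W.
change (dz g) with (fun w => (/ 2 * (cdx g w - Ci * cdy g w))%C).
rewrite (wirtinger_dzbar _ _ _ _ W), !dzbar_pair.
unfold laplacian.
pose proof (pdx_pdy_comm D (fun w => Re (g w)) z HD (proj1 Hg) Hz) as E1.
pose proof (pdx_pdy_comm D (fun w => Im (g w)) z HD (proj2 Hg) Hz) as E2.
unfold cdx, cdy; apply injective_projections; simpl;
 change (fun w : C => pdy (fun w0 : C => Re (g w0)) w) with (pdy (fun w0 : C => Re (g w0)));
 change (fun w : C => pdy (fun w0 : C => Im (g w0)) w) with (pdy (fun w0 : C => Im (g w0)));
 change (fun w : C => pdx (fun w0 : C => Re (g w0)) w) with (pdx (fun w0 : C => Re (g w0)));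
 change (fun w : C => pdx (fun w0 : C => Im (g w0)) w) with (pdx (fun w0 : C => Im (g w0)));
  rewrite ?E1, ?E2; field.
Qed.

Lemma dz_dzbar_comm (D : C -> Prop) g z :
  open D -> smoothC D g -> D z -> dz (dzbar g) z = dzbar (dz g) z.
Proof.
intros HD Hg Hz.
assert (Gx : smoothC D (cdx g)) by (split; apply smooth_pdx; apply Hg).
assert (Gy : smoothC D (cdy g)) by (split; apply smooth_pdy; apply Hg).
pose proof (wirtinger_mult _ _ z _ _ _ _ (wirtinger_const (/ 2)%C z)
  (wirtinger_minus _ _ _ _ _ _ _ (wirtinger_smooth D _ z Gx Hz)
    (wirtinger_mult _ _ z _ _ _ _ (wirtinger_const Ci z)
       (wirtinger_smooth D _ z Gy Hz)))) as W.
pose proof (wirtinger_mult _ _ z _ _ _ _ (wirtinger_const (/ 2)%C z)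
  (wirtinger_plus _ _ _ _ _ _ _ (wirtinger_smooth D _ z Gx Hz)
    (wirtinger_mult _ _ z _ _ _ _ (wirtinger_const Ci z)
       (wirtinger_smooth D _ z Gy Hz)))) as W'.
change (dz g) with (fun w => (/ 2 * (cdx g w - Ci * cdy g w))%C).
change (dzbar g) with (fun w => (/ 2 * (cdx g w + Ci * cdy g w))%C).
rewrite (wirtinger_dzbar _ _ _ _ W), (wirtinger_dz _ _ _ _ W'), !dzbar_pair, !dz_pair.
pose proof (pdx_pdy_comm D (fun w => Re (g w)) z HD (proj1 Hg) Hz) as E1.
pose proof (pdx_pdy_comm D (fun w => Im (g w)) z HD (proj2 Hg) Hz) as E2.
unfold cdx, cdy; apply injective_projections; simpl;
 change (fun w : C => pdy (fun w0 : C => Re (g w0)) w) with (pdy (fun w0 : C => Re (g w0)));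
 change (fun w : C => pdy (fun w0 : C => Im (g w0)) w) with (pdy (fun w0 : C => Im (g w0)));
 change (fun w : C => pdx (fun w0 : C => Re (g w0)) w) with (pdx (fun w0 : C => Re (g w0)));
 change (fun w : C => pdx (fun w0 : C => Im (g w0)) w) with (pdx (fun w0 : C => Im (g w0)));
  rewrite ?E1, ?E2; field.
Qed.

(** * Mean curvature under holomorphic reparametrization *)

Lemma is_pdx_scal c g z l : is_pdx g z l -> is_pdx (fun w => c * g w) z (c * l).
Proof. apply (is_derive_scal (fun t => g (t, snd z))). Qed.

Lemma is_pdy_scal c g z l : is_pdy g z l -> is_pdy (fun w => c * g w) z (c * l).
Proof. apply (is_derive_scal (fun t => g (fst z, t))). Qed.

Lemma is_pdx_shift c g z l : is_pdx g z l -> is_pdx (fun w => c + g w) z l.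
Proof.
intros H; eapply is_pdx_eq.
- exact (is_pdx_plus _ _ _ _ _ (is_derive_const c (fst z)) H).
- unfold zero; simpl; ring.
Qed.

Lemma is_pdy_shift c g z l : is_pdy g z l -> is_pdy (fun w => c + g w) z l.
Proof.
intros H; eapply is_pdy_eq.
- exact (is_pdy_plus _ _ _ _ _ (is_derive_const c (snd z)) H).
- unfold zero; simpl; ring.
Qed.

(** Left translation only changes the third component: it subtracts x1 dx2, as
    in the metric. *)
Lemma mcx_eq (f : C -> Nil) z a b c :
  is_pdx (fun w => n1 (f w)) z a -> is_pdx (fun w => n2 (f w)) z b ->
  is_pdx (fun w => n3 (f w)) z c -> mcx f z = (a, b, c - n1 (f z) * b).
Proof.
intros Ha Hb Hc; unfold mcx, pdx3; simpl.
f_equal; [f_equal|].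
- apply is_pdx_unique; now apply is_pdx_shift.
- apply is_pdx_unique; now apply is_pdx_shift.
- apply is_pdx_unique.
  eapply is_pdx_eq; [apply (is_pdx_plus _ _ _ _ _ (is_pdx_shift _ _ _ _ Hc)
    (is_pdx_scal _ _ _ _ Hb)) | ring].
Qed.

Lemma mcy_eq (f : C -> Nil) z a b c :
  is_pdy (fun w => n1 (f w)) z a -> is_pdy (fun w => n2 (f w)) z b ->
  is_pdy (fun w => n3 (f w)) z c -> mcy f z = (a, b, c - n1 (f z) * b).
Proof.
intros Ha Hb Hc; unfold mcy, pdy3; simpl.
f_equal; [f_equal|].
- apply is_pdy_unique; now apply is_pdy_shift.
- apply is_pdy_unique; now apply is_pdy_shift.
- apply is_pdy_unique.
  eapply is_pdy_eq; [apply (is_pdy_plus _ _ _ _ _ (is_pdy_shift _ _ _ _ Hc)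
    (is_pdy_scal _ _ _ _ Hb)) | ring].
Qed.

Definition smoothV3 (D : C -> Prop) (g : C -> V3) : Prop :=
  smooth D (fun w => v1 (g w)) /\ smooth D (fun w => v2 (g w)) /\
  smooth D (fun w => v3 (g w)).

Lemma smoothV3_mcx (D : C -> Prop) f : open D -> smoothNil D f -> smoothV3 D (mcx f).
Proof.
intros HD [H1 [H2 H3]].
assert (E : forall w, D w -> mcx f w = (pdx (fun w => n1 (f w)) w, pdx (fun w => n2 (f w)) w,
   pdx (fun w => n3 (f w)) w - n1 (f w) * pdx (fun w => n2 (f w)) w)).
{ intros w Hw; apply mcx_eq; now apply smooth_is_pdx with D. }
split; [|split].
- eapply smooth_ext; [auto| |apply smooth_pdx, H1]; intros w Hw; rewrite E; auto.
- eapply smooth_ext; [auto| |apply smooth_pdx, H2]; intros w Hw; rewrite E; auto.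
- eapply smooth_ext; [auto| |apply (smooth_minus D _ _ HD (smooth_pdx _ _ H3)
     (smooth_mult D _ _ HD H1 (smooth_pdx _ _ H2)))]; intros w Hw; rewrite E; auto.
Qed.

Lemma smoothV3_mcy (D : C -> Prop) f : open D -> smoothNil D f -> smoothV3 D (mcy f).
Proof.
intros HD [H1 [H2 H3]].
assert (E : forall w, D w -> mcy f w = (pdy (fun w => n1 (f w)) w, pdy (fun w => n2 (f w)) w,
   pdy (fun w => n3 (f w)) w - n1 (f w) * pdy (fun w => n2 (f w)) w)).
{ intros w Hw; apply mcy_eq; now apply smooth_is_pdy with D. }
split; [|split].
- eapply smooth_ext; [auto| |apply smooth_pdy, H1]; intros w Hw; rewrite E; auto.
- eapply smooth_ext; [auto| |apply smooth_pdy, H2]; intros w Hw; rewrite E; auto.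
- eapply smooth_ext; [auto| |apply (smooth_minus D _ _ HD (smooth_pdy _ _ H3)
     (smooth_mult D _ _ HD H1 (smooth_pdy _ _ H2)))]; intros w Hw; rewrite E; auto.
Qed.

Lemma nil_metric_pdx f D z : smoothNil D f -> D z ->
  let X := pdx3 (fun w => coords (f w)) z in
  let Y := pdy3 (fun w => coords (f w)) z in
  nil_metric (f z) X X = dot (mcx f z) (mcx f z) /\
  nil_metric (f z) X Y = dot (mcx f z) (mcy f z) /\
  nil_metric (f z) Y Y = dot (mcy f z) (mcy f z).
Proof.
intros [H1 [H2 H3]] Hz X Y.
rewrite (mcx_eq f z _ _ _ (smooth_is_pdx D _ z H1 Hz) (smooth_is_pdx D _ z H2 Hz)
  (smooth_is_pdx D _ z H3 Hz)).
rewrite (mcy_eq f z _ _ _ (smooth_is_pdy D _ z H1 Hz) (smooth_is_pdy D _ z H2 Hz)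
  (smooth_is_pdy D _ z H3 Hz)).
repeat split.
Qed.

(** The metric is left-invariant, so conformality can be read off after
    translation to the identity. *)
Lemma conformal_mc D f : smoothNil D f ->
  conformal D f <->
  (forall z, D z -> dot (mcx f z) (mcx f z) = dot (mcy f z) (mcy f z) /\
     dot (mcx f z) (mcy f z) = 0 /\ 0 < dot (mcx f z) (mcx f z)).
Proof.
intros Hf; split; intros H z Hz; specialize (H z Hz);
  destruct (nil_metric_pdx f D z Hf Hz) as [E1 [E2 E3]]; simpl in H.
- now rewrite E1, E2, E3 in H.
- simpl; now rewrite E1, E2, E3.
Qed.

(** Under a holomorphic change of parameter with chi' = p + i q the pair of
    tangent vectors X, Y becomes lin p q X Y, lin (- q) p X Y. *)
Definition lin (p q : R) (u w : V3) : V3 :=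
  (p * v1 u + q * v1 w, p * v2 u + q * v2 w, p * v3 u + q * v3 w).

Lemma dot_lin p q p' q' (X Y : V3) :
  dot (lin p q X Y) (lin p' q' X Y)
  = p * p' * dot X X + (p * q' + q * p') * dot X Y + q * q' * dot Y Y.
Proof. unfold dot, lin, v1, v2, v3; simpl; ring. Qed.

Lemma dot_cross (X Y : V3) :
  dot (cross X Y) (cross X Y) = dot X X * dot Y Y - dot X Y * dot X Y.
Proof. unfold dot, cross, v1, v2, v3; simpl; ring. Qed.

(** The cross product is multiplied by p^2 + q^2 > 0, so the unit normal,
    orientation included, is unchanged. *)
Lemma normal_lin p q (X Y : V3) : 0 < p ^ 2 + q ^ 2 ->
  let n := cross X Y in
  let n' := cross (lin p q X Y) (lin (- q) p X Y) in
  0 < dot n n ->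
  (v1 n' / sqrt (dot n' n'), v2 n' / sqrt (dot n' n'), v3 n' / sqrt (dot n' n'))
  = (v1 n / sqrt (dot n n), v2 n / sqrt (dot n n), v3 n / sqrt (dot n n)).
Proof.
intros Hl n n' Hn.
assert (E : n' = ((p^2+q^2) * v1 n, (p^2+q^2) * v2 n, (p^2+q^2) * v3 n)).
{ unfold n, n', cross, lin, v1, v2, v3; simpl; f_equal; [f_equal|]; ring. }
assert (Q : sqrt (dot n' n') = (p^2+q^2) * sqrt (dot n n)).
{ rewrite <- (sqrt_Rsqr (p^2+q^2)) by lra.
  rewrite <- sqrt_mult by (apply Rle_0_sqr || lra).
  f_equal; rewrite E; unfold dot, Rsqr, v1, v2, v3; simpl; ring. }
rewrite Q, E; unfold v1, v2, v3; simpl.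
specialize (sqrt_lt_R0 _ Hn); intros Hs.
f_equal; [f_equal|]; field; split; try lra; simpl in Hl; lra.
Qed.

Section Conformal_change.

Context {D D' : C -> Prop} {f : C -> Nil} {chi : C -> C}.
Context (HD : open D) (HD' : open D') (Hm : forall w, D' w -> D (chi w))
  (Hf : smoothNil D f) (Hchi : holomorphic D' chi).

Lemma smoothNil_comp : smoothNil D' (fun w => f (chi w)).
Proof.
destruct Hf as [H1 [H2 H3]]; split; [|split].
- apply (smooth_comp D D' (fun w => n1 (f w))); auto; apply Hchi.
- apply (smooth_comp D D' (fun w => n2 (f w))); auto; apply Hchi.
- apply (smooth_comp D D' (fun w => n3 (f w))); auto; apply Hchi.
Qed.

Lemma pdx_comp_holo g w : smooth D g -> D' w ->
  is_pdx (fun w => g (chi w)) w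
    (Re (dz chi w) * pdx g (chi w) + Im (dz chi w) * pdy g (chi w)).
Proof.
intros Hg Hw.
destruct (wirtinger_holomorphic D' chi w Hchi Hw) as [H1 [H2 _]].
eapply is_pdx_eq; [apply (is_pdx_comp g chi w _ _ _ _
  (smooth_has_gradient D g (chi w) HD Hg (Hm w Hw)) H1 H2) | simpl; ring].
Qed.

Lemma pdy_comp_holo g w : smooth D g -> D' w ->
  is_pdy (fun w => g (chi w)) w
    (- Im (dz chi w) * pdx g (chi w) + Re (dz chi w) * pdy g (chi w)).
Proof.
intros Hg Hw.
destruct (wirtinger_holomorphic D' chi w Hchi Hw) as [_ [_ [H1 H2]]].
eapply is_pdy_eq; [apply (is_pdy_comp g chi w _ _ _ _
  (smooth_has_gradient D g (chi w) HD Hg (Hm w Hw)) H1 H2) | simpl; ring].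
Qed.

Lemma mcx_comp w : D' w ->
  mcx (fun w => f (chi w)) w
  = lin (Re (dz chi w)) (Im (dz chi w)) (mcx f (chi w)) (mcy f (chi w)).
Proof.
intros Hw; destruct Hf as [H1 [H2 H3]]; pose proof (Hm w Hw) as Hz.
rewrite (mcx_eq f (chi w) _ _ _ (smooth_is_pdx D _ _ H1 Hz) (smooth_is_pdx D _ _ H2 Hz)
  (smooth_is_pdx D _ _ H3 Hz)).
rewrite (mcy_eq f (chi w) _ _ _ (smooth_is_pdy D _ _ H1 Hz) (smooth_is_pdy D _ _ H2 Hz)
  (smooth_is_pdy D _ _ H3 Hz)).
rewrite (mcx_eq _ _ _ _ _ (pdx_comp_holo _ w H1 Hw) (pdx_comp_holo _ w H2 Hw)
  (pdx_comp_holo _ w H3 Hw)).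
unfold lin, v1, v2, v3; simpl; f_equal; ring.
Qed.

Lemma mcy_comp w : D' w ->
  mcy (fun w => f (chi w)) w
  = lin (- Im (dz chi w)) (Re (dz chi w)) (mcx f (chi w)) (mcy f (chi w)).
Proof.
intros Hw; destruct Hf as [H1 [H2 H3]]; pose proof (Hm w Hw) as Hz.
rewrite (mcx_eq f (chi w) _ _ _ (smooth_is_pdx D _ _ H1 Hz) (smooth_is_pdx D _ _ H2 Hz)
  (smooth_is_pdx D _ _ H3 Hz)).
rewrite (mcy_eq f (chi w) _ _ _ (smooth_is_pdy D _ _ H1 Hz) (smooth_is_pdy D _ _ H2 Hz)
  (smooth_is_pdy D _ _ H3 Hz)).
rewrite (mcy_eq _ _ _ _ _ (pdy_comp_holo _ w H1 Hw) (pdy_comp_holo _ w H2 Hw)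
  (pdy_comp_holo _ w H3 Hw)).
unfold lin, v1, v2, v3; simpl; f_equal; ring.
Qed.

(** The second-order part of the mean curvature in a conformal parameter is
    the trace X_x + Y_y. Under the change of parameter the mixed terms cancel,
    and the derivatives of chi' contribute only multiples of X and Y, with
    coefficients common to all components; these are tangent and disappear
    against the normal. *)
Lemma divergence_comp w : D' w ->
  exists a b : R, forall X Y : C -> R, smooth D X -> smooth D Y ->
  pdx (fun w => Re (dz chi w) * X (chi w) + Im (dz chi w) * Y (chi w)) w
  + pdy (fun w => - Im (dz chi w) * X (chi w) + Re (dz chi w) * Y (chi w)) w
  = a * X (chi w) + b * Y (chi w)
    + (Re (dz chi w) ^ 2 + Im (dz chi w) ^ 2) * (pdx X (chi w) + pdy Y (chi w)).
Proof.
intros Hw.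
destruct (smoothC_dz D' chi HD' (proj1 Hchi)) as [Sr Si].
exists (pdx (fun w => Re (dz chi w)) w - pdy (fun w => Im (dz chi w)) w),
       (pdx (fun w => Im (dz chi w)) w + pdy (fun w => Re (dz chi w)) w).
intros X Y HX HY.
rewrite (is_pdx_unique _ _ _ (is_pdx_plus _ _ _ _ _
  (is_pdx_mult _ _ _ _ _ (smooth_is_pdx _ _ _ Sr Hw) (pdx_comp_holo X w HX Hw))
  (is_pdx_mult _ _ _ _ _ (smooth_is_pdx _ _ _ Si Hw) (pdx_comp_holo Y w HY Hw)))).
rewrite (is_pdy_unique _ _ _ (is_pdy_plus _ _ _ _ _
  (is_pdy_mult _ _ _ _ _ (is_pdy_opp _ _ _ (smooth_is_pdy _ _ _ Si Hw)) (pdy_comp_holo X w HX Hw))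
  (is_pdy_mult _ _ _ _ _ (smooth_is_pdy _ _ _ Sr Hw) (pdy_comp_holo Y w HY Hw)))).
ring.
Qed.

End Conformal_change.

(** With E = G and F = 0 only the trace of the second fundamental form
    remains. *)
Lemma mean_curvature_conformal f z (X := mcx f z) (Y := mcy f z) (N := normal f z) :
  dot X X = dot Y Y -> dot X Y = 0 -> 0 < dot X X ->
  mean_curvature f z =
  (dot (pdx (fun w => v1 (mcx f w)) z + pdy (fun w => v1 (mcy f w)) z,
        pdx (fun w => v2 (mcx f w)) z + pdy (fun w => v2 (mcy f w)) z,
        pdx (fun w => v3 (mcx f w)) z + pdy (fun w => v3 (mcy f w)) z) N
   + dot (nabla X X) N + dot (nabla Y Y) N) / (2 * dot X X).
Proof.
intros HE HF H0; unfold mean_curvature.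
change (mcx f z) with X; change (mcy f z) with Y; change (normal f z) with N.
rewrite <- HE, HF.
match goal with |- _ = (dot ?u _ + _ + _) / _ =>
  replace (dot u N) with (dot (pdx3 (mcx f) z) N + dot (pdy3 (mcy f) z) N)
    by (unfold pdx3, pdy3; generalize (pdx (fun w => v1 (mcx f w)) z),
      (pdx (fun w => v2 (mcx f w)) z), (pdx (fun w => v3 (mcx f w)) z),
      (pdy (fun w => v1 (mcy f w)) z), (pdy (fun w => v2 (mcy f w)) z),
      (pdy (fun w => v3 (mcy f w)) z), N;
      intros; unfold dot, v1, v2, v3; simpl; ring) end.
field; lra.
Qed.

(** In conformal parameters the trace of the second fundamental form and the
    factor E are both multiplied by |chi'|^2. *)
Lemma mean_curvature_comp (D D' : C -> Prop) (f : C -> Nil) (chi : C -> C) (w : C) :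
  open D -> open D' -> (forall w, D' w -> D (chi w)) ->
  smoothNil D f -> conformal D f -> holomorphic D' chi ->
  D' w -> dz chi w <> 0 ->
  mean_curvature (fun w => f (chi w)) w = mean_curvature f (chi w).
Proof.
intros HD HD' Hm Hf Hc Hchi Hw Hnz.
pose proof (proj1 (conformal_mc D f Hf) Hc (chi w) (Hm w Hw)) as [HE [HF HP]].
pose proof (C_neq_0_norm2 _ Hnz) as Hl.
pose proof (mcx_comp HD Hm Hf Hchi w Hw) as EX.
pose proof (mcy_comp HD Hm Hf Hchi w Hw) as EY.
destruct (divergence_comp HD HD' Hm Hchi w Hw) as [a [b Hdiv]].
destruct (smoothV3_mcx D f HD Hf) as [X1 [X2 X3]].
destruct (smoothV3_mcy D f HD Hf) as [Y1 [Y2 Y3]].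
assert (EN : normal (fun w => f (chi w)) w = normal f (chi w)).
{ unfold normal; rewrite EX, EY; apply normal_lin; auto.
  rewrite dot_cross, HF, <- HE; nra. }
assert (T : forall i : V3 -> R,
  (forall p q u w, i (lin p q u w) = p * i u + q * i w) ->
  smooth D (fun w => i (mcx f w)) -> smooth D (fun w => i (mcy f w)) ->
  pdx (fun w => i (mcx (fun w => f (chi w)) w)) w
  + pdy (fun w => i (mcy (fun w => f (chi w)) w)) w
  = a * i (mcx f (chi w)) + b * i (mcy f (chi w))
    + (Re (dz chi w) ^ 2 + Im (dz chi w) ^ 2)
      * (pdx (fun w => i (mcx f w)) (chi w) + pdy (fun w => i (mcy f w)) (chi w))).
{ intros i Hi Sx Sy.
  rewrite <- (Hdiv (fun w => i (mcx f w)) (fun w => i (mcy f w)) Sx Sy); f_equal.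
  - apply pdx_ext with D'; auto; intros w' Hw'.
    rewrite (mcx_comp HD Hm Hf Hchi w' Hw'); apply Hi.
  - apply pdy_ext with D'; auto; intros w' Hw'.
    rewrite (mcy_comp HD Hm Hf Hchi w' Hw'); apply Hi. }
assert (NX : dot (mcx f (chi w)) (normal f (chi w)) = 0).
{ unfold normal; generalize (mcx f (chi w)) (mcy f (chi w)); intros.
  unfold dot, cross, Rdiv, v1, v2, v3; simpl; ring. }
assert (NY : dot (mcy f (chi w)) (normal f (chi w)) = 0).
{ unfold normal; generalize (mcx f (chi w)) (mcy f (chi w)); intros.
  unfold dot, cross, Rdiv, v1, v2, v3; simpl; ring. }
rewrite (mean_curvature_conformal f (chi w)) by auto.
rewrite mean_curvature_conformal; rewrite ?EX, ?EY.
- rewrite EN, (T v1), (T v2), (T v3); auto.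
  set (N := normal f (chi w)) in *.
  set (p := Re (dz chi w)) in *; set (q := Im (dz chi w)) in *.
  revert HE HF HP NX NY.
  generalize (pdx (fun w => v1 (mcx f w)) (chi w) + pdy (fun w => v1 (mcy f w)) (chi w)).
  generalize (pdx (fun w => v2 (mcx f w)) (chi w) + pdy (fun w => v2 (mcy f w)) (chi w)).
  generalize (pdx (fun w => v3 (mcx f w)) (chi w) + pdy (fun w => v3 (mcy f w)) (chi w)).
  destruct (mcx f (chi w)) as [[x1 x2] x3], (mcy f (chi w)) as [[y1 y2] y3].
  destruct N as [[m1 m2] m3]; intros t3 t2 t1 HE HF HP NX NY.
  assert (EE : dot (lin p q (x1, x2, x3) (y1, y2, y3)) (lin p q (x1, x2, x3) (y1, y2, y3))
    = (p ^ 2 + q ^ 2) * dot (x1, x2, x3) (x1, x2, x3)).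
  { rewrite dot_lin, HF, <- HE; ring. }
  rewrite EE.
  match goal with |- ?L / _ = ?M / _ => assert (LM : L = (p ^ 2 + q ^ 2) * M) end.
  { apply Rminus_diag_uniq.
    replace (_ - _) with (a * dot (x1, x2, x3) (m1, m2, m3) + b * dot (y1, y2, y3) (m1, m2, m3)).
    - rewrite NX, NY; ring.
    - unfold nabla, koszul, bracket, dot, lin, v1, v2, v3; simpl; field. }
  rewrite LM; field; split; lra.
- rewrite !dot_lin, HF, HE; ring.
- rewrite !dot_lin, HF, HE; ring.
- rewrite !dot_lin, HF, <- HE; nra.
Qed.

(** * Spinors of a minimal surface *)

(** The potential U for H = 0, in terms of a = psi1 and b = conj psi2. *)
Definition spin_potential (a b : C -> C) (w : C) : C :=
  (Ci / 4 * (b w * Cconj (b w) - a w * Cconj (a w)))%C.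

(** The value of Atilde for H = 0, in terms of a = psi1 and b = conj psi2. *)
Definition spin_wronskian (a b : C -> C) (w : C) : C := (b w * dz a w - a w * dz b w)%C.

(** The Dirac equation for H = 0, with the first equation conjugated: since U
    is imaginary, this makes it symmetric in a and b. *)
Record minimal_spinors (D : C -> Prop) (a b : C -> C) : Prop := {
  ms_smooth_a : smoothC D a;
  ms_smooth_b : smoothC D b;
  ms_dirac_a : forall w, D w -> (dzbar a w = spin_potential a b w * Cconj (b w))%C;
  ms_dirac_b : forall w, D w -> (dzbar b w = spin_potential a b w * Cconj (a w))%C
}.

Lemma Ci_sqr : (Ci * Ci = - (1))%C.
Proof. apply injective_projections; simpl; ring. Qed.

Lemma spin_potential_pair a b w :
  spin_potential a b w = (0, (Cmod (b w) ^ 2 - Cmod (a w) ^ 2) / 4).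
Proof.
unfold spin_potential, Cmod; rewrite !pow2_sqrt by nra.
apply injective_projections; simpl; field.
Qed.

Lemma spin_potential_conj a b w :
  Cconj (spin_potential a b w) = (- spin_potential a b w)%C.
Proof. rewrite spin_potential_pair; apply injective_projections; simpl; ring. Qed.

Section Minimal_spinors.
Context {D : C -> Prop} {a b : C -> C} (HD : open D) (H : minimal_spinors D a b).

Let Sa := ms_smooth_a D a b H.
Let Sb := ms_smooth_b D a b H.

Lemma spin_potential_smooth : smoothC D (spin_potential a b).
Proof.
unfold spin_potential; apply (smoothC_mult D); auto using smoothC_const.
apply smoothC_minus; auto; apply smoothC_mult; auto using smoothC_conj.
Qed.

Let SU := spin_potential_smooth.

Lemma wirtinger_spin_a w : D w ->
  wirtinger a w (dz a w) (spin_potential a b w * Cconj (b w))%C.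
Proof.
intros Hw; rewrite <- (ms_dirac_a D a b H w Hw); now apply wirtinger_smooth with D.
Qed.

Lemma wirtinger_spin_b w : D w ->
  wirtinger b w (dz b w) (spin_potential a b w * Cconj (a w))%C.
Proof.
intros Hw; rewrite <- (ms_dirac_b D a b H w Hw); now apply wirtinger_smooth with D.
Qed.

(** The contributions of the Dirac equation cancel: they are opposite
    multiples of U a b in dz U, and of its conjugate in dzbar U. *)
Lemma wirtinger_potential w : D w ->
  wirtinger (spin_potential a b) w
    (Ci / 4 * (Cconj (b w) * dz b w - Cconj (a w) * dz a w))%C
    (Ci / 4 * (b w * Cconj (dz b w) - a w * Cconj (dz a w)))%C.
Proof.
intros Hw.
pose proof (wirtinger_spin_a w Hw) as Wa; pose proof (wirtinger_spin_b w Hw) as Wb.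
eapply wirtinger_eq.
- apply (wirtinger_mult _ _ w _ _ _ _ (wirtinger_const (Ci / 4)%C w)
    (wirtinger_minus _ _ w _ _ _ _
      (wirtinger_mult _ _ w _ _ _ _ Wb (wirtinger_conj _ _ _ _ Wb))
      (wirtinger_mult _ _ w _ _ _ _ Wa (wirtinger_conj _ _ _ _ Wa)))).
- rewrite !Cmult_conj, !Cconj_conj, spin_potential_conj; ring.
- ring.
Qed.

(** dzbar and dz commute, so this is dz of the Dirac equation. *)
Lemma dzbar_dz_spin_a w : D w ->
  (dzbar (dz a) w = dz (spin_potential a b) w * Cconj (b w)
    - spin_potential a b w * spin_potential a b w * a w)%C.
Proof.
intros Hw.
rewrite <- (dz_dzbar_comm D) by auto.
rewrite (dz_ext D _ _ w HD Hw (ms_dirac_a D a b H)).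
erewrite wirtinger_dz by
  (apply (wirtinger_mult _ _ w _ _ _ _ (wirtinger_smooth D _ w SU Hw)
    (wirtinger_conj _ _ _ _ (wirtinger_spin_b w Hw)))).
rewrite !Cmult_conj, !Cconj_conj, spin_potential_conj; ring.
Qed.

Lemma dzbar_dz_spin_b w : D w ->
  (dzbar (dz b) w = dz (spin_potential a b) w * Cconj (a w)
    - spin_potential a b w * spin_potential a b w * b w)%C.
Proof.
intros Hw.
rewrite <- (dz_dzbar_comm D) by auto.
rewrite (dz_ext D _ _ w HD Hw (ms_dirac_b D a b H)).
erewrite wirtinger_dz by
  (apply (wirtinger_mult _ _ w _ _ _ _ (wirtinger_smooth D _ w SU Hw)
    (wirtinger_conj _ _ _ _ (wirtinger_spin_a w Hw)))).
rewrite !Cmult_conj, !Cconj_conj, spin_potential_conj; ring.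
Qed.

Lemma wronskian_smooth : smoothC D (spin_wronskian a b).
Proof.
apply smoothC_minus; auto; apply smoothC_mult; auto using smoothC_dz.
Qed.

(** In dzbar A the terms with U dz a and U dz b collect to U (conj a dz a -
    conj b dz b), and those with dz U to (|b|^2 - |a|^2) dz U, which is its
    opposite. *)
Lemma wronskian_holomorphic w : D w -> dzbar (spin_wronskian a b) w = 0.
Proof.
intros Hw.
pose proof (wirtinger_spin_a w Hw) as Wa; pose proof (wirtinger_spin_b w Hw) as Wb.
unfold spin_wronskian.
erewrite wirtinger_dzbar by (apply (wirtinger_minus _ _ w _ _ _ _
  (wirtinger_mult _ _ w _ _ _ _ Wb (wirtinger_smooth D _ w (smoothC_dz D a HD Sa) Hw))
  (wirtinger_mult _ _ w _ _ _ _ Wa (wirtinger_smooth D _ w (smoothC_dz D b HD Sb) Hw)))).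
rewrite dzbar_dz_spin_a, dzbar_dz_spin_b by auto.
rewrite (wirtinger_dz _ _ _ _ (wirtinger_potential w Hw)).
unfold spin_potential; field [Ci_sqr].
Qed.

(** dzbar dz U equals (i/4)(|dz b|^2 - |dz a|^2) - U^3. Since dzbar U = - conj
    (dz U), the left side is U dzbar dz U + |dz U|^2; with |dz U|^2 = |conj b
    dz b - conj a dz a|^2 / 16 its first-order terms add up to |b dz a - a dz
    b|^2 / 16. *)
Lemma potential_equation w : D w ->
  let U := spin_potential a b in
  (U w * dzbar (dz U) w - dz U w * dzbar U w
   = spin_wronskian a b w * Cconj (spin_wronskian a b w) / 16 - U w * U w * (U w * U w))%C.
Proof.
intros Hw; cbv zeta.
pose proof (wirtinger_spin_a w Hw) as Wa; pose proof (wirtinger_spin_b w Hw) as Wb.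
pose proof (wirtinger_potential w Hw) as WU.
rewrite (dzbar_ext D _ _ w HD Hw
  (fun z Hz => wirtinger_dz _ _ _ _ (wirtinger_potential z Hz))).
rewrite (wirtinger_dzbar _ _ _ _
   (wirtinger_mult _ _ w _ _ _ _ (wirtinger_const (Ci / 4)%C w)
    (wirtinger_minus _ _ w _ _ _ _
      (wirtinger_mult _ _ w _ _ _ _ (wirtinger_conj _ _ _ _ Wb)
        (wirtinger_smooth D _ w (smoothC_dz D b HD Sb) Hw))
      (wirtinger_mult _ _ w _ _ _ _ (wirtinger_conj _ _ _ _ Wa)
        (wirtinger_smooth D _ w (smoothC_dz D a HD Sa) Hw))))).
rewrite (wirtinger_dz _ _ _ _ WU), (wirtinger_dzbar _ _ _ _ WU).
rewrite dzbar_dz_spin_a, dzbar_dz_spin_b by auto.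
rewrite (wirtinger_dz _ _ _ _ (wirtinger_potential w Hw)).
unfold spin_wronskian; rewrite Cminus_conj, !Cmult_conj.
unfold spin_potential; field [Ci_sqr].
Qed.

End Minimal_spinors.

(** * Logarithms of the potential *)

Lemma cexp_plus x y : cexp (x + y) = (cexp x * cexp y)%C.
Proof.
unfold cexp, Re, Im; apply injective_projections; simpl;
  rewrite exp_plus, ?cos_plus, ?sin_plus; ring.
Qed.

Lemma cexp_opp_r x : (cexp x * cexp (- x) = 1)%C.
Proof.
rewrite <- cexp_plus; unfold cexp; apply injective_projections; simpl;
  rewrite !Rplus_opp_r, exp_0, ?cos_0, ?sin_0; ring.
Qed.

Lemma cexp_neq_0 x : cexp x <> 0.
Proof.
intros E; pose proof (cexp_opp_r x) as E'.
rewrite E, Cmult_0_l in E'; injection E'; lra.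
Qed.

Lemma cexp_opp x : cexp (- x) = (/ cexp x)%C.
Proof.
pose proof (cexp_neq_0 x) as N.
rewrite <- (Cmult_1_l (/ _)%C), <- (cexp_opp_r x); field; auto.
Qed.

(** On the set where Im U keeps the sign that it has at w0, the argument of U
    is constantly pi/2 or - pi/2. *)
Lemma continuous_log_exists (D : C -> Prop) (U : C -> C) (w0 : C) :
  open D -> (forall w, D w -> continuous U w) -> (forall w, D w -> Re (U w) = 0) ->
  D w0 -> U w0 <> 0 ->
  exists (V : C -> Prop) (v : C -> C),
    open V /\ V w0 /\ (forall w, V w -> D w) /\ continuous_log V v U.
Proof.
intros HD HU HR Hw0 Hnz.
set (q := fun w => Im (U w)).
assert (Hq : forall w, D w -> continuous q w).
{ intros w Hw; now apply continuous_C, HU. }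
assert (N0 : q w0 <> 0).
{ intros E; apply Hnz; apply injective_projections; [now apply HR | exact E]. }
exists (fun w => D w /\ 0 < q w0 * q w),
  (fun w => (ln (Rabs (q w)), if Rlt_dec 0 (q w0) then PI / 2 else - (PI / 2))).
split; [|split; [|split]].
- apply open_positive; auto; intros w Hw.
  apply (continuous_mult (fun _ => q w0) q); auto; apply continuous_const.
- split; auto; nra.
- now intros w [].
- intros w [Hw Hp]; split.
  + apply continuous_C; split; simpl; [|apply continuous_const].
    apply (continuous_comp (fun w => Rabs (q w)) ln).
    * apply (continuous_comp q Rabs); [now apply Hq | apply continuous_Rabs].
    * apply continuous_ln, Rabs_pos_lt; nra.
  + unfold cexp; simpl; rewrite exp_ln by (apply Rabs_pos_lt; nra).
    apply injective_projections; simpl.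
    * fold (Re (U w)); rewrite (HR w Hw).
      destruct Rlt_dec; rewrite ?cos_neg, cos_PI2; ring.
    * fold (Im (U w)); change (Im (U w)) with (q w).
      destruct Rlt_dec; rewrite ?sin_neg, sin_PI2.
      -- assert (0 < q w) by (clearbody q; nra); rewrite Rabs_pos_eq; lra.
      -- assert (q w < 0) by (clearbody q; nra); rewrite Rabs_left; lra.
Qed.

Lemma sin_eq_0_small t : Rabs t < 1 -> sin t = 0 -> t = 0.
Proof.
intros Ht Hs; apply Rabs_def2 in Ht; pose proof PI2_1.
destruct (Rtotal_order t 0) as [L|[E|G]]; auto; exfalso.
- pose proof (sin_gt_0 (- t)) as K; rewrite sin_neg in K; lra.
- pose proof (sin_gt_0 t) as K; lra.
Qed.

Section Imaginary_log.
Context {V : C -> Prop} {U v : C -> C} (HV : open V) (HU : smoothC V U)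
  (HR : forall w, V w -> Re (U w) = 0) (Hv : continuous_log V v U).

Lemma log_im_part w : V w -> cos (Im (v w)) = 0 /\ exp (Re (v w)) * sin (Im (v w)) = Im (U w).
Proof.
intros Hw; pose proof (proj2 (Hv w Hw)) as E; pose proof (HR w Hw) as R0.
rewrite <- E in *; unfold cexp in *; simpl in *; split; auto.
pose proof (exp_pos (Re (v w))); nra.
Qed.

(** Two zeros of the cosine at distance less than 1 are equal, and Im v is
    continuous. *)
Lemma log_im_locally_constant w : V w ->
  exists V' : C -> Prop, open V' /\ V' w /\ forall w', V' w' -> Im (v w') = Im (v w).
Proof.
intros Hw; exists (fun w' => locally w' (fun w' => Im (v w') = Im (v w))).
split; [|split].
- intros w' Hw'; now apply locally_locally.
- pose proof (proj1 (Hv w Hw)) as Cv; apply continuous_C in Cv; destruct Cv as [_ Cv].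
  assert (B : locally w (fun w' => Rabs (Im (v w') - Im (v w)) < 1)).
  { apply (Cv (fun t => Rabs (t - Im (v w)) < 1)).
    exists (mkposreal 1 Rlt_0_1); intros t Ht; exact Ht. }
  apply filter_imp with (2 := filter_and _ _ B (HV w Hw)); intros w' [H1 H2].
  apply Rminus_diag_uniq, sin_eq_0_small; auto.
  rewrite sin_minus, (proj1 (log_im_part w Hw)), (proj1 (log_im_part w' H2)); ring.
- intros w' Hw'; exact (locally_singleton _ _ Hw').
Qed.

Lemma log_im_partials w : V w ->
  is_pdx (fun w => Im (v w)) w 0 /\ is_pdy (fun w => Im (v w)) w 0.
Proof.
intros Hw; destruct (log_im_locally_constant w Hw) as [V' [O [Hw' E]]]; split.
- apply is_pdx_ext with V' (fun _ => Im (v w)); auto; [intros; symmetry; auto|].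
  apply (is_derive_const (Im (v w)) (fst w)).
- apply is_pdy_ext with V' (fun _ => Im (v w)); auto; [intros; symmetry; auto|].
  apply (is_derive_const (Im (v w)) (snd w)).
Qed.

(** The square avoids the absolute value, which is not smooth: Re v = ln (Im
    U)^2 / 2. *)
Lemma log_re_part w : V w -> 0 < Im (U w) * Im (U w) /\ Re (v w) = / 2 * ln (Im (U w) * Im (U w)).
Proof.
intros Hw; destruct (log_im_part w Hw) as [H1 H2].
assert (E : Im (U w) * Im (U w) = exp (Re (v w) + Re (v w))).
{ rewrite <- H2, exp_plus.
  pose proof (sin2_cos2 (Im (v w))) as K; rewrite H1 in K; unfold Rsqr in K.
  replace (_ * _ * _) with (exp (Re (v w)) * exp (Re (v w)) * (sin (Im (v w)) * sin (Im (v w)))) by ring.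
  replace (sin (Im (v w)) * sin (Im (v w))) with 1 by lra; ring. }
rewrite E, ln_exp; split; [apply exp_pos | field].
Qed.

Lemma log_smooth : smoothC V v.
Proof.
split.
- apply smooth_ext with (fun w => / 2 * ln (Im (U w) * Im (U w))); auto.
  { intros w Hw; symmetry; now apply log_re_part. }
  apply smooth_mult; auto using smooth_const; apply smooth_ln; auto.
  + intros w Hw; now apply log_re_part.
  + apply smooth_mult; auto; apply HU.
- intros [|n].
  + intros w Hw; apply continuous_C, Hv, Hw.
  + apply Ck_S_intro with (fun _ => 0) (fun _ => 0); auto using Ck_const;
    intros w Hw; now apply log_im_partials.
Qed.

(** Re v has the logarithmic derivative of Im U and Im v is locally constant.
    *)
Lemma log_dz w : V w -> (dz v w * U w = dz U w)%C.
Proof.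
intros Hw; destruct (log_im_partials w Hw) as [Ix Iy].
pose proof (proj2 (log_re_part w Hw)) as E.
assert (Ep : 0 < Im (U w) * Im (U w)) by now apply log_re_part.
pose proof (smooth_is_pdx _ _ _ (proj2 HU) Hw) as Ux.
pose proof (smooth_is_pdy _ _ _ (proj2 HU) Hw) as Uy.
rewrite !dz_pair, (is_pdx_unique _ _ _ Ix), (is_pdy_unique _ _ _ Iy).
rewrite (pdx_ext V (fun w => Re (v w)) (fun w => / 2 * ln (Im (U w) * Im (U w)))),
  (pdy_ext V (fun w => Re (v w)) (fun w => / 2 * ln (Im (U w) * Im (U w))))
  by (auto; intros; now apply log_re_part).
rewrite (is_pdx_unique _ _ _ (is_pdx_scal _ _ _ _ (is_pdx_ln _ _ _ Ep (is_pdx_mult _ _ _ _ _ Ux Ux)))).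
rewrite (is_pdy_unique _ _ _ (is_pdy_scal _ _ _ _ (is_pdy_ln _ _ _ Ep (is_pdy_mult _ _ _ _ _ Uy Uy)))).
rewrite (pdx_ext V (fun w => Re (U w)) (fun _ => 0)),
  (pdy_ext V (fun w => Re (U w)) (fun _ => 0)) by auto.
rewrite (is_pdx_unique (fun _ => 0) w 0) by apply (is_derive_const 0 (fst w)).
rewrite (is_pdy_unique (fun _ => 0) w 0) by apply (is_derive_const 0 (snd w)).
assert (N : Im (U w) <> 0) by nra.
apply injective_projections; simpl; fold (Re (U w)) (Im (U w));
 change (fst (U w)) with (Re (U w)); change (snd (U w)) with (Im (U w));
 rewrite (HR w Hw); field; auto.
Qed.

(** Apply dzbar to the relation dz v U = dz U. *)
Lemma log_laplacian w : V w ->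
  (laplacian v w * (U w * U w) = 4 * (U w * dzbar (dz U) w - dz U w * dzbar U w))%C.
Proof.
intros Hw.
rewrite (laplacian_dzbar_dz V) by auto using log_smooth.
pose proof (wirtinger_dzbar _ _ _ _
  (wirtinger_mult _ _ _ _ _ _ _
    (wirtinger_smooth V _ w (smoothC_dz V v HV log_smooth) Hw)
    (wirtinger_smooth V _ w HU Hw))) as E.
rewrite (dzbar_ext V _ _ w HV Hw log_dz) in E.
rewrite E, <- (log_dz w Hw); ring.
Qed.

End Imaginary_log.

(** With |A|^2 = 16 the equation of the potential reads U^2 Laplacian v = 4 (1
    - U^4), and U^2 = exp 2v. *)
Lemma log_solves (D V : C -> Prop) a b v :
  open D -> minimal_spinors D a b ->
  (forall w, D w -> spin_wronskian a b w = 4 * Ci)%C ->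
  open V -> (forall w, V w -> D w) -> continuous_log V v (spin_potential a b) ->
  solves_system V v.
Proof.
intros HD Hm Hh HV HVD Hv.
assert (HU : smoothC V (spin_potential a b)).
{ apply smoothC_subset with D; auto; now apply spin_potential_smooth. }
assert (HR : forall w, V w -> Re (spin_potential a b w) = 0).
{ intros; now rewrite spin_potential_pair. }
split; [now apply (log_smooth HV HU HR Hv)|].
intros w Hw; rewrite <- and_comm; split.
{ rewrite (proj2 (Hv w Hw)); auto. }
pose proof (log_laplacian HV HU HR Hv w Hw) as L.
rewrite (potential_equation HD Hm w (HVD w Hw)), (Hh w (HVD w Hw)) in L.
unfold csinh.
replace (2 * v w)%C with (v w + v w)%C by ring.
rewrite cexp_opp, cexp_plus, (proj2 (Hv w Hw)).
assert (N : spin_potential a b w <> 0).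
{ rewrite <- (proj2 (Hv w Hw)); apply cexp_neq_0. }
set (u := spin_potential a b w) in *.
assert (laplacian v w = 4 * (1 - u * u * (u * u)) / (u * u))%C as ->.
{ replace (laplacian v w) with (laplacian v w * (u * u) / (u * u))%C by (field; auto).
  rewrite L.
  replace (Cconj (4 * Ci)) with (- (4 * Ci))%C
    by (apply injective_projections; simpl; ring).
  field [Ci_sqr]; auto. }
field; auto.
Qed.

Lemma potential_minimal f psi1 psi2 w : mean_curvature f w = 0 ->
  potential f psi1 psi2 w = spin_potential psi1 (fun w => Cconj (psi2 w)) w.
Proof.
intros H0; unfold potential; rewrite H0, spin_potential_pair, Cmod_conj.
apply injective_projections; simpl; field.
Qed.

Lemma weierstrass_minimal_spinors (D : C -> Prop) f psi1 psi2 :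
  open D -> weierstrass D f psi1 psi2 -> minimal D f ->
  minimal_spinors D psi1 (fun w => Cconj (psi2 w)).
Proof.
intros HD W M; split.
- apply W.
- apply smoothC_conj; auto; apply W.
- intros w Hw; rewrite <- potential_minimal with (f := f) by auto.
  pose proof (w_dirac2 _ _ _ _ W w Hw) as E.
  rewrite Cconj_conj.
  transitivity (dzbar psi1 w + (- dzbar psi1 w + potential f psi1 psi2 w * psi2 w))%C;
    [rewrite E; ring | ring].
- intros w Hw.
  rewrite (wirtinger_dzbar _ _ _ _ (wirtinger_conj _ _ _ _
    (wirtinger_smooth D _ w (w_smooth2 _ _ _ _ W) Hw))).
  pose proof (w_dirac1 _ _ _ _ W w Hw) as E.
  rewrite potential_minimal in E by auto.
  replace (dz psi2 w) with (- (spin_potential psi1 (fun w => Cconj (psi2 w)) w * psi1 w))%C.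
  + rewrite Copp_conj, Cmult_conj, spin_potential_conj; ring.
  + rewrite <- (Cplus_0_r (- _)%C), <- E; ring.
Qed.

Lemma Atilde_minimal f psi1 psi2 w : mean_curvature f w = 0 ->
  Atilde f psi1 psi2 w = spin_wronskian psi1 (fun w => Cconj (psi2 w)) w.
Proof.
intros H0; unfold Atilde, spin_wronskian; rewrite H0; simpl; unfold Cdiv; ring.
Qed.

(** * Holomorphic square roots and primitives *)

Definition principal_sqrt (c : C) : C :=
  let t := sqrt ((Cmod c + Re c) / 2) in (t, Im c / (2 * t)).

Lemma Cmod_plus_Re_pos c : 0 < Re c -> 0 < (Cmod c + Re c) / 2.
Proof. intros H; pose proof (Cmod_ge_0 c); lra. Qed.

Lemma principal_sqrt_sqr c : 0 < Cmod c + Re c ->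
  (principal_sqrt c * principal_sqrt c = c)%C.
Proof.
intros H; assert (H' : 0 < (Cmod c + Re c) / 2) by lra.
pose proof (sqrt_lt_R0 _ H') as Ht; pose proof (sqrt_sqrt _ (Rlt_le _ _ H')) as Hs.
unfold principal_sqrt; set (t := sqrt _) in *.
assert (E : Im c ^ 2 = Cmod c ^ 2 - Re c ^ 2).
{ unfold Cmod; rewrite pow2_sqrt by nra; unfold Re, Im; ring. }
apply injective_projections; simpl; fold (Re c) (Im c).
- replace (t * t - Im c / (2 * t) * (Im c / (2 * t))) with (t * t - Im c ^ 2 / (4 * (t * t))) by (field; lra).
  rewrite Hs, E; field; lra.
- field; lra.
Qed.

Lemma Csqrt_exists c : exists k : C, (k * k = c)%C.
Proof.
destruct (Rle_lt_or_eq_dec 0 (Cmod c + Re c)) as [H|H].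
- pose proof (re_le_Cmod c) as K; apply Rabs_le_between in K; lra.
- exists (principal_sqrt c); now apply principal_sqrt_sqr.
- assert (E : Im c ^ 2 = Cmod c ^ 2 - Re c ^ 2).
  { unfold Cmod; rewrite pow2_sqrt by nra; unfold Re, Im; ring. }
  pose proof (Cmod_ge_0 c).
  exists (0, sqrt (Cmod c)).
  pose proof (sqrt_sqrt (Cmod c) (Cmod_ge_0 c)) as S2.
  assert (Im c = 0) by nra.
  apply injective_projections; simpl; fold (Re c) (Im c); nra.
Qed.

(** Divided by its value at z0, the function m takes values in the right
    half-plane near z0, where the principal root is an explicit smooth
    formula. A smooth root is holomorphic: dzbar of s^2 is 2 s dzbar s, and s
    has no zeros. *)
Lemma local_holomorphic_sqrt (D : C -> Prop) (m : C -> C) z0 :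
  open D -> holomorphic D m -> D z0 -> m z0 <> 0 ->
  exists (D0 : C -> Prop) (s : C -> C),
    open D0 /\ D0 z0 /\ (forall z, D0 z -> D z) /\ holomorphic D0 s /\
    forall z, D0 z -> (s z * s z = m z)%C /\ s z <> 0.
Proof.
intros HD [Hs Hh] Hz0 N0.
destruct (Csqrt_exists (m z0)) as [k Hk].
set (g := fun z => (/ m z0 * m z)%C).
assert (Sg : smoothC D g) by (apply smoothC_mult; auto using smoothC_const).
set (D0 := fun z => D z /\ 0 < Re (g z)).
assert (HD0 : open D0).
{ apply open_positive; auto; intros w Hw; now apply (smooth_continuous D _ _ (proj1 Sg)). }
assert (P0 : forall z, D0 z -> 0 < (Cmod (g z) + Re (g z)) / 2).
{ intros z [_ Hz]; now apply Cmod_plus_Re_pos. }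
assert (Sg0 : smoothC D0 g) by (apply smoothC_subset with D; auto; now intros z []).
assert (St : smooth D0 (fun z => sqrt ((Cmod (g z) + Re (g z)) / 2))).
{ apply smooth_sqrt; auto; apply smooth_mult; auto using smooth_const.
  apply smooth_plus; auto; [|apply Sg0].
  apply smooth_sqrt; auto.
  - intros z [_ Hz]; revert Hz; generalize (g z); intros [x y] Hz; simpl in *; nra.
  - destruct Sg0; simpl; apply smooth_plus; auto; repeat apply smooth_mult; auto using smooth_const. }
set (s := fun z => (k * principal_sqrt (g z))%C).
assert (Ss : smoothC D0 s).
{ apply smoothC_mult; auto using smoothC_const; split; [exact St|].
  apply (smooth_mult D0 (fun z => Im (g z))
    (fun z => / (2 * sqrt ((Cmod (g z) + Re (g z)) / 2)))); auto; [apply Sg0|].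
  apply smooth_inv; auto.
  - intros z Hz; specialize (sqrt_lt_R0 _ (P0 z Hz)); lra.
  - apply smooth_mult; auto using smooth_const. }
assert (Es : forall z, D0 z -> (s z * s z = m z)%C).
{ intros z Hz; transitivity (k * k * (principal_sqrt (g z) * principal_sqrt (g z)))%C;
    [unfold s; ring|].
  rewrite principal_sqrt_sqr by (specialize (P0 z Hz); lra).
  rewrite Hk; unfold g; field; auto. }
assert (Ns : forall z, D0 z -> s z <> 0).
{ intros z Hz E; pose proof (Es z Hz) as E'; rewrite E, Cmult_0_l in E'.
  destruct Hz as [_ Hz]; unfold g in Hz; rewrite <- E', Cmult_0_r in Hz; simpl in Hz; lra. }
clearbody s.
exists D0, s.
split; [exact HD0|split; [|split; [now intros z []|split; [split; [exact Ss|]|]]]].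
- split; auto; unfold g; rewrite Cinv_l by auto; simpl; lra.
- intros z Hz.
  pose proof (wirtinger_smooth D0 _ z Ss Hz) as W.
  pose proof (wirtinger_dzbar _ _ _ _ (wirtinger_mult _ _ _ _ _ _ _ W W)) as E.
  rewrite (dzbar_ext D0 _ m z HD0 Hz Es), Hh in E by apply Hz.
  specialize (Ns z Hz).
  transitivity ((dzbar s z * s z + s z * dzbar s z) / (2 * s z))%C; [field; auto|].
  rewrite <- E; field; auto.
- intros z Hz; auto.
Qed.

(** Squares fit the product uniform structure of the plane, and are stable
    under moving one coordinate at a time. *)
Definition square (z0 : C) (r : R) (z : C) : Prop :=
  Rabs (Re z - Re z0) < r /\ Rabs (Im z - Im z0) < r.

Lemma square_open z0 r : open (square z0 r).
Proof.
assert (Hd : forall g : C -> R, (forall w, continuous g w) -> forall c,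
  forall w : C, continuous (fun w => r - Rabs (g w - c)) w).
{ intros g Hg c w.
  apply (continuous_minus (fun _ => r) (fun w => Rabs (g w - c))); [apply continuous_const|].
  apply (continuous_comp (fun w => g w - c) Rabs); [|apply continuous_Rabs].
  apply (continuous_minus g (fun _ => c)); [apply Hg | apply continuous_const]. }
apply open_ext with (fun z => (True /\ 0 < r - Rabs (Re z - Re z0)) /\ 0 < r - Rabs (Im z - Im z0)).
{ intros z; unfold square; split; intros; intuition lra. }
apply open_positive; [apply open_positive; [apply open_true|]|]; intros w _; apply Hd;
  intros; [apply continuous_fst | apply continuous_snd].
Qed.

Lemma open_contains_square (D : C -> Prop) z0 : open D -> D z0 ->
  exists r, 0 < r /\ forall z, square z0 r z -> D z.
Proof.
intros HD Hz; destruct (open_locally_2d D z0 HD Hz) as [d Hd].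
exists d; split; [apply cond_pos|]; intros [x y] [H1 H2]; now apply Hd.
Qed.

Lemma between_abs x0 x t r : Rabs (x - x0) < r -> Rmin x0 x <= t <= Rmax x0 x ->
  Rabs (t - x0) < r.
Proof.
intros H1 H2; apply Rabs_def1; apply Rabs_def2 in H1;
  unfold Rmin, Rmax in H2; destruct (Rle_dec x0 x); lra.
Qed.

Lemma between_locally x0 x r : Rabs (x - x0) < r ->
  locally x (fun x' => Rabs (x' - x0) < r).
Proof.
intros H; exists (mkposreal (r - Rabs (x - x0)) ltac:(lra)); intros y Hy.
change (Rabs (y - x) < r - Rabs (x - x0)) in Hy.
replace (y - x0) with ((y - x) + (x - x0)) by ring.
pose proof (Rabs_triang (y - x) (x - x0)); lra.
Qed.

(** The potential is the integral of P along the horizontal segment at height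
    Im z0 followed by that of Q along the vertical one. Differentiating the
    second integral under the integral sign in x gives the integral of Q_x =
    P_y, which restores P at the upper end. *)
Lemma closed_form_potential z0 r (P Q : C -> R) :
  smooth (square z0 r) P -> smooth (square z0 r) Q ->
  (forall z, square z0 r z -> pdy P z = pdx Q z) ->
  exists h : C -> R, forall z, square z0 r z -> is_pdx h z (P z) /\ is_pdy h z (Q z).
Proof.
intros HP HQ E; set (x0 := Re z0); set (y0 := Im z0).
pose proof (square_open z0 r) as HO.
exists (fun z => RInt (fun t => P (t, y0)) x0 (Re z) + RInt (fun s => Q (Re z, s)) y0 (Im z)).
assert (Px : forall x, Rabs (x - x0) < r -> continuous (fun t => P (t, y0)) x).
{ intros x Hx; assert (Hz : square z0 r (x, y0)).
  { split; simpl; auto; fold y0; rewrite Rminus_diag, Rabs_R0.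
    pose proof (Rabs_pos (x - x0)); lra. }
  apply (@ex_derive_continuous R_AbsRing R_NormedModule).
  exists (pdx P (x, y0)); exact (smooth_is_pdx _ _ _ HP Hz). }
assert (Qy : forall x y, square z0 r (x, y) -> continuous (fun s => Q (x, s)) y).
{ intros x y Hz; apply (@ex_derive_continuous R_AbsRing R_NormedModule).
  exists (pdy Q (x, y)); exact (smooth_is_pdy _ _ _ HQ Hz). }
assert (IP : forall x, Rabs (x - x0) < r -> ex_RInt (fun t => P (t, y0)) x0 x).
{ intros x Hx; apply (@ex_RInt_continuous R_CompleteNormedModule).
  intros t Ht; apply Px; eapply between_abs; eauto. }
assert (IQ : forall x y, square z0 r (x, y) -> ex_RInt (fun s => Q (x, s)) y0 y).
{ intros x y [Hx Hy]; apply (@ex_RInt_continuous R_CompleteNormedModule).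
  intros t Ht; apply Qy; split; auto; simpl; eapply between_abs; eauto. }
intros [x y] Hz; destruct (Hz) as [Hx Hy]; simpl in Hx, Hy; split.
- replace (P (x, y)) with (P (x, y0) + (P (x, y) - P (x, y0))) by ring.
  apply (is_pdx_plus (fun z => RInt (fun t => P (t, y0)) x0 (Re z))
    (fun z => RInt (fun s => Q (Re z, s)) y0 (Im z))).
  + apply (is_derive_RInt (fun t => P (t, y0)) (fun x => RInt (fun t => P (t, y0)) x0 x) x0).
    * apply filter_imp with (2 := between_locally x0 x r Hx); intros x' Hx'.
      now apply (@RInt_correct R_CompleteNormedModule), IP.
    * now apply Px.
  + assert (D1 : RInt (fun s => Derive (fun u => Q (u, s)) x) y0 y = P (x, y) - P (x, y0)).
    { apply is_RInt_unique.
      apply is_RInt_ext with (fun s => pdy P (x, s)).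
      - intros s Hs; apply E; split; auto; simpl.
        eapply between_abs; eauto; fold y0; lra.
      - apply (is_RInt_derive (fun s => P (x, s)) (fun s => pdy P (x, s))).
        + intros s Hs; apply (smooth_is_pdy _ _ (x, s) HP); split; auto; simpl.
          eapply between_abs; eauto.
        + intros s Hs; apply (@ex_derive_continuous R_AbsRing R_NormedModule).
          exists (pdy (pdy P) (x, s)); apply (smooth_is_pdy _ _ (x, s) (smooth_pdy _ _ HP)).
          split; auto; simpl; eapply between_abs; eauto. }
    rewrite <- D1.
    apply (is_derive_RInt_param (fun u s => Q (u, s)) y0 y x).
    * apply filter_imp with (2 := between_locally x0 x r Hx); intros x' Hx' t Ht.
      exists (pdx Q (x', t)); apply (smooth_is_pdx _ _ (x', t) HQ); split; auto; simpl.
      eapply between_abs; eauto.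
    * intros t Ht; apply (continuous_continuity_2d (pdx Q) (x, t)).
      apply smooth_continuous with (square z0 r); [now apply smooth_pdx|].
      split; auto; simpl; eapply between_abs; eauto.
    * apply filter_imp with (2 := between_locally x0 x r Hx); intros x' Hx'.
      apply IQ; now split.
- replace (Q (x, y)) with (0 + Q (x, y)) by ring.
  apply (is_pdy_plus (fun z => RInt (fun t => P (t, y0)) x0 (Re z))
    (fun z => RInt (fun s => Q (Re z, s)) y0 (Im z))).
  + apply (is_derive_const (RInt (fun t => P (t, y0)) x0 x) y).
  + apply (is_derive_RInt (fun t => Q (x, t)) (fun y => RInt (fun t => Q (x, t)) y0 y) y0).
    * apply filter_imp with (2 := between_locally y0 y r Hy); intros y' Hy'.
      apply (@RInt_correct R_CompleteNormedModule), IQ; now split.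
    * now apply Qy.
Qed.

Lemma holomorphic_intro (D : C -> Prop) F g :
  open D -> smoothC D g -> (forall z, D z -> wirtinger F z (g z) 0) ->
  holomorphic D F.
Proof.
intros HD [Sr Si] W; split; [|intros z Hz; eapply wirtinger_dzbar; eauto].
split; intros n; apply Ck_pred; auto.
- apply Ck_S_intro with (fun z => Re (g z)) (fun z => - Im (g z)); auto using Ck_opp;
   intros z Hz; destruct (W z Hz) as [H1 [H2 [H3 H4]]]; simpl in *.
  + eapply is_pdx_eq; [exact H1 | ring].
  + eapply is_pdy_eq; [exact H3 | ring].
- apply Ck_S_intro with (fun z => Im (g z)) (fun z => Re (g z)); auto;
   intros z Hz; destruct (W z Hz) as [H1 [H2 [H3 H4]]]; simpl in *.
  + eapply is_pdx_eq; [exact H2 | ring].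
  + eapply is_pdy_eq; [exact H4 | ring].
Qed.

(** The Cauchy-Riemann equations say that Re g dx - Im g dy and Im g dx + Re g
    dy are closed; their potentials are the real and imaginary parts of the
    primitive. *)
Lemma holomorphic_primitive z0 r g : holomorphic (square z0 r) g ->
  exists F : C -> C, forall z, square z0 r z -> wirtinger F z (g z) 0.
Proof.
intros Hg; pose proof (square_open z0 r) as HO; destruct (Hg) as [[Sr Si] _].
destruct (closed_form_potential z0 r (fun z => Re (g z)) (fun z => - Im (g z)))
  as [u Hu]; auto using smooth_opp.
{ intros z Hz; destruct (wirtinger_holomorphic _ _ _ Hg Hz) as [H1 [H2 [H3 H4]]].
  rewrite (is_pdy_unique _ _ _ H3), (is_pdx_unique _ _ _ (is_pdx_opp _ _ _ H2)); simpl; ring. }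
destruct (closed_form_potential z0 r (fun z => Im (g z)) (fun z => Re (g z)))
  as [v Hv]; auto.
{ intros z Hz; destruct (wirtinger_holomorphic _ _ _ Hg Hz) as [H1 [H2 [H3 H4]]].
  rewrite (is_pdy_unique _ _ _ H4), (is_pdx_unique _ _ _ H1); simpl; ring. }
exists (fun z => (u z, v z)); intros z Hz.
destruct (Hu z Hz) as [H1 H2], (Hv z Hz) as [H3 H4].
split; [|split; [|split]]; simpl.
- eapply is_pdx_eq; [exact H1 | ring].
- eapply is_pdx_eq; [exact H3 | ring].
- eapply is_pdy_eq; [exact H2 | ring].
- eapply is_pdy_eq; [exact H4 | ring].
Qed.

(** * Contractions and mean values in the sup norm *)

(** The norm whose balls are squares; it is the one in which total
    differentiability of functions of two variables is stated. *)
Definition supnorm (z : C) : R := Rmax (Rabs (Re z)) (Rabs (Im z)).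

Lemma supnorm_le z r : supnorm z <= r <-> Rabs (Re z) <= r /\ Rabs (Im z) <= r.
Proof.
unfold supnorm; split.
- intros H; split; eapply Rle_trans; eauto; [apply Rmax_l | apply Rmax_r].
- intros [H1 H2]; now apply Rmax_lub.
Qed.

Lemma supnorm_Re z : Rabs (Re z) <= supnorm z.
Proof. apply Rmax_l. Qed.

Lemma supnorm_Im z : Rabs (Im z) <= supnorm z.
Proof. apply Rmax_r. Qed.

Lemma supnorm_pos z : 0 <= supnorm z.
Proof. eapply Rle_trans; [apply Rabs_pos | apply supnorm_Re]. Qed.

Lemma supnorm_plus z w : supnorm (z + w) <= supnorm z + supnorm w.
Proof.
pose proof (supnorm_Re z); pose proof (supnorm_Im z).
pose proof (supnorm_Re w); pose proof (supnorm_Im w).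
apply supnorm_le; split; (eapply Rle_trans; [apply Rabs_triang|]); unfold Re, Im in *; lra.
Qed.

Lemma supnorm_opp z : supnorm (- z) = supnorm z.
Proof. unfold supnorm; simpl; now rewrite !Rabs_Ropp. Qed.

Lemma supnorm_mult z w : supnorm (z * w) <= 2 * supnorm z * supnorm w.
Proof.
pose proof (supnorm_Re z); pose proof (supnorm_Im z).
pose proof (supnorm_Re w); pose proof (supnorm_Im w).
pose proof (Rabs_pos (Re z)); pose proof (Rabs_pos (Im z)).
pose proof (Rabs_pos (Re w)); pose proof (Rabs_pos (Im w)).
assert (K : forall a b c d, 0 <= a -> 0 <= b -> a <= c -> b <= d -> a * b <= c * d).
{ intros; nra. }
apply supnorm_le; split; simpl.
- unfold Rminus; eapply Rle_trans; [apply Rabs_triang|]; rewrite Rabs_Ropp, !Rabs_mult.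
  pose proof (K (Rabs (Re z)) (Rabs (Re w)) (supnorm z) (supnorm w)).
  pose proof (K (Rabs (Im z)) (Rabs (Im w)) (supnorm z) (supnorm w)).
  unfold Re, Im in *; lra.
- eapply Rle_trans; [apply Rabs_triang|]; rewrite !Rabs_mult.
  pose proof (K (Rabs (Re z)) (Rabs (Im w)) (supnorm z) (supnorm w)).
  pose proof (K (Rabs (Im z)) (Rabs (Re w)) (supnorm z) (supnorm w)).
  unfold Re, Im in *; lra.
Qed.

Lemma supnorm_eq_0 z : supnorm z <= 0 -> z = 0.
Proof.
intros H; apply supnorm_le in H; destruct H as [H1 H2].
apply injective_projections; simpl; apply Rabs_eq_0; apply Rle_antisym; auto; apply Rabs_pos.
Qed.

(** The increments are dominated by a geometric series. *)
Lemma fast_cauchy_cv (u : nat -> R) d :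
  (forall n, Rabs (u (S n) - u n) <= d * (/ 2) ^ n) -> exists l : R, is_lim_seq u l.
Proof.
intros H.
assert (Ex : ex_series (fun n => u (S n) - u n)).
{ apply (ex_series_le (fun n => u (S n) - u n) (fun n => d * (/ 2) ^ n)); [exact H|].
  apply (ex_series_scal (V := R_NormedModule)).
  apply ex_series_geom; rewrite Rabs_pos_eq; lra. }
destruct Ex as [l Hl]; exists (u O + l).
apply is_lim_seq_incr_1.
apply is_lim_seq_ext with (fun n => u O + sum_n (fun n => u (S n) - u n) n).
{ intros n; induction n as [|n IH]; [rewrite sum_O; ring|].
  rewrite sum_Sn; unfold plus; simpl; simpl in IH; lra. }
apply (is_lim_seq_plus' (fun _ => u O)); [apply is_lim_seq_const | exact Hl].
Qed.

(** The iterates of z0 stay within distance r, since the first step has length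
    at most r / 2, and their increments decrease geometrically. *)
Lemma contraction_fixed_point (T : C -> C) z0 r :
  (forall z z', supnorm (z - z0) <= r -> supnorm (z' - z0) <= r ->
     supnorm (T z - T z') <= / 2 * supnorm (z - z')) ->
  supnorm (T z0 - z0) <= / 2 * r ->
  exists z, supnorm (z - z0) <= r /\ T z = z.
Proof.
intros HT H0.
assert (Hr : 0 <= r) by (pose proof (supnorm_pos (T z0 - z0)); lra).
pose (u := fun n => Nat.iter n T z0).
assert (Hin : forall n, supnorm (u n - z0) <= r).
{ induction n as [|n IH].
  - simpl; replace (z0 - z0)%C with (RtoC 0) by ring.
    unfold supnorm; simpl; rewrite Rabs_R0, Rmax_left; lra.
  - replace (u (S n) - z0)%C with ((T (u n) - T z0) + (T z0 - z0))%C by (simpl; ring).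
    eapply Rle_trans; [apply supnorm_plus|].
    assert (supnorm (z0 - z0) <= r).
    { replace (z0 - z0)%C with (RtoC 0) by ring.
      unfold supnorm; simpl; rewrite Rabs_R0, Rmax_left; lra. }
    specialize (HT (u n) z0 IH H); lra. }
assert (Hstep : forall n, supnorm (u (S n) - u n) <= (/ 2 * r) * (/ 2) ^ n).
{ induction n as [|n IH]; [simpl; lra|].
  specialize (HT (u (S n)) (u n) (Hin _) (Hin _)).
  change (u (S (S n))) with (T (u (S n))); change (T (u n)) with (u (S n)) in HT.
  simpl pow; lra. }
destruct (fast_cauchy_cv (fun n => Re (u n)) (/ 2 * r)) as [x Hx].
{ intros n; eapply Rle_trans; [apply (supnorm_Re (u (S n) - u n)) | apply Hstep]. }
destruct (fast_cauchy_cv (fun n => Im (u n)) (/ 2 * r)) as [y Hy].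
{ intros n; eapply Rle_trans; [apply (supnorm_Im (u (S n) - u n)) | apply Hstep]. }
assert (Lim : forall e, 0 < e -> exists n, supnorm (u n - (x, y)) <= e /\ supnorm (u (S n) - (x, y)) <= e).
{ intros e He.
  apply is_lim_seq_spec in Hx; apply is_lim_seq_spec in Hy.
  destruct (Hx (mkposreal e He)) as [Nx Kx], (Hy (mkposreal e He)) as [Ny Ky].
  simpl in Kx, Ky.
  exists (Nx + Ny)%nat; split; apply supnorm_le; split; apply Rlt_le.
  - apply (Kx (Nx + Ny)%nat); lia.
  - apply (Ky (Nx + Ny)%nat); lia.
  - apply (Kx (S (Nx + Ny))); lia.
  - apply (Ky (S (Nx + Ny))); lia. }
assert (Hz : supnorm ((x, y) - z0) <= r).
{ apply le_epsilon; intros e He; destruct (Lim e He) as [n [Hn _]].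
  replace ((x, y) - z0)%C with (- (u n - (x, y)) + (u n - z0))%C by ring.
  eapply Rle_trans; [apply supnorm_plus|]; rewrite supnorm_opp.
  specialize (Hin n); lra. }
exists (x, y); split; auto.
assert (E0 : (T (x, y) - (x, y))%C = 0).
{ apply supnorm_eq_0; apply le_epsilon; intros e He.
  destruct (Lim (e / 2) ltac:(lra)) as [n [Hn1 Hn2]].
  replace (T (x, y) - (x, y))%C with (- (T (u n) - T (x, y)) + (u (S n) - (x, y)))%C
    by (simpl; ring).
  eapply Rle_trans; [apply supnorm_plus|]; rewrite supnorm_opp.
  specialize (HT (u n) (x, y) (Hin n) Hz); lra. }
transitivity (T (x, y) - (x, y) + (x, y))%C; [ring | rewrite E0; ring].
Qed.

Lemma square_supnorm z0 r z : square z0 r z <-> supnorm (z - z0) < r.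
Proof.
unfold square, supnorm; simpl; split.
- intros [H1 H2]; now apply Rmax_lub_lt.
- intros H; split; eapply Rle_lt_trans; eauto; [apply Rmax_l | apply Rmax_r].
Qed.

(** Move from z' to z along the two sides of a rectangle contained in the
    square, and use the one-variable mean value theorem on each side. *)
Lemma mean_value_square z0 r (G : C -> R) Gx Gy e :
  (forall z, square z0 r z -> is_pdx G z (Gx z) /\ is_pdy G z (Gy z)) ->
  (forall z, square z0 r z -> Rabs (Gx z) <= e /\ Rabs (Gy z) <= e) ->
  forall z z', square z0 r z -> square z0 r z' ->
  Rabs (G z - G z') <= 2 * e * supnorm (z - z').
Proof.
intros HG He [x y] [x' y'] [Hx Hy] [Hx' Hy']; simpl in *.
assert (B : forall a b c t, Rabs (a - c) < r -> Rabs (b - c) < r ->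
   Rmin a b <= t <= Rmax a b -> Rabs (t - c) < r).
{ intros a b c t Ha Hb Ht; apply Rabs_def2 in Ha; apply Rabs_def2 in Hb; apply Rabs_def1;
    unfold Rmin, Rmax in Ht; destruct (Rle_dec a b); lra. }
destruct (MVT_gen (fun t => G (t, y)) x' x (fun t => Gx (t, y))) as [c [Hc Ec]].
{ intros t Ht; apply (HG (t, y)); split; simpl; auto; apply (B x' x); auto; lra. }
{ intros t Ht; apply continuity_pt_filterlim.
  apply (@ex_derive_continuous R_AbsRing R_NormedModule); exists (Gx (t, y)).
  apply (HG (t, y)); split; simpl; auto; apply (B x' x); auto; lra. }
destruct (MVT_gen (fun t => G (x', t)) y' y (fun t => Gy (x', t))) as [d [Hd Ed]].
{ intros t Ht; apply (HG (x', t)); split; simpl; auto; apply (B y' y); auto; lra. }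
{ intros t Ht; apply continuity_pt_filterlim.
  apply (@ex_derive_continuous R_AbsRing R_NormedModule); exists (Gy (x', t)).
  apply (HG (x', t)); split; simpl; auto; apply (B y' y); auto; lra. }
replace (G (x, y) - G (x', y')) with (Gx (c, y) * (x - x') + Gy (x', d) * (y - y'))
  by (rewrite <- Ec, <- Ed; ring).
assert (K1 : Rabs (Gx (c, y)) <= e) by (apply He; split; simpl; auto; apply (B x' x); auto).
assert (K2 : Rabs (Gy (x', d)) <= e) by (apply He; split; simpl; auto; apply (B y' y); auto).
pose proof (supnorm_Re ((x, y) - (x', y'))) as N1.
pose proof (supnorm_Im ((x, y) - (x', y'))) as N2.
simpl in N1, N2; fold (x - x') in N1; fold (y - y') in N2.
eapply Rle_trans; [apply Rabs_triang|]; rewrite !Rabs_mult.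
pose proof (Rabs_pos (Gx (c, y))); pose proof (Rabs_pos (Gy (x', d))).
pose proof (Rabs_pos (x - x')); pose proof (Rabs_pos (y - y')).
set (n := supnorm _) in *.
assert (Rabs (Gx (c, y)) * Rabs (x - x') <= e * n) by nra.
assert (Rabs (Gy (x', d)) * Rabs (y - y') <= e * n) by nra.
lra.
Qed.

(** * Holomorphic local inverses *)

(** Complex differentiability at a point. Unlike a pair of partial derivatives
    it is inherited by a Lipschitz inverse. *)
Definition complex_derivative (F : C -> C) (z g : C) : Prop :=
  forall eps, 0 < eps -> exists d, 0 < d /\ forall z', supnorm (z' - z) < d ->
    supnorm (F z' - F z - g * (z' - z)) <= eps * supnorm (z' - z).

Lemma complex_derivative_gradient F z g :
  complex_derivative F z g <->
  has_gradient (fun w => Re (F w)) z (Re g) (- Im g) /\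
  has_gradient (fun w => Im (F w)) z (Im g) (Re g).
Proof.
assert (ER : forall u v, Re (F (u, v) - F z - g * ((u, v) - z)) =
  Re (F (u, v)) - Re (F (fst z, snd z)) - (Re g * (u - fst z) + - Im g * (v - snd z))).
{ intros u v; destruct z; unfold Re, Im; simpl; ring. }
assert (EI : forall u v, Im (F (u, v) - F z - g * ((u, v) - z)) =
  Im (F (u, v)) - Im (F (fst z, snd z)) - (Im g * (u - fst z) + Re g * (v - snd z))).
{ intros u v; destruct z; unfold Re, Im; simpl; ring. }
split.
- intros H; split; intros eps; destruct (H eps (cond_pos eps)) as [d [Hd K]];
    exists (mkposreal d Hd); intros u v Hu Hv; simpl in Hu, Hv;
    specialize (K (u, v) (proj1 (square_supnorm z d (u, v)) (conj Hu Hv)));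
    apply supnorm_le in K; destruct K as [K1 K2].
  + now rewrite ER in K1.
  + now rewrite EI in K2.
- intros [H1 H2] eps He.
  destruct (H1 (mkposreal eps He)) as [d1 K1], (H2 (mkposreal eps He)) as [d2 K2].
  exists (Rmin d1 d2); split; [apply Rmin_pos; apply cond_pos|].
  intros [u v] Hz; apply square_supnorm in Hz; destruct Hz as [Hu Hv]; simpl in Hu, Hv.
  pose proof (Rmin_l d1 d2); pose proof (Rmin_r d1 d2).
  apply supnorm_le; rewrite ER, EI; split.
  + apply (K1 u v); unfold Re, Im in *; lra.
  + apply (K2 u v); unfold Re, Im in *; lra.
Qed.

Lemma complex_derivative_wirtinger F z g : complex_derivative F z g -> wirtinger F z g 0.
Proof.
intros H; apply complex_derivative_gradient in H; destruct H as [H1 H2].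
split; [|split; [|split]]; simpl.
- eapply is_pdx_eq; [eapply has_gradient_is_pdx, H1 | ring].
- eapply is_pdx_eq; [eapply has_gradient_is_pdx, H2 | ring].
- eapply is_pdy_eq; [eapply has_gradient_is_pdy, H1 | ring].
- eapply is_pdy_eq; [eapply has_gradient_is_pdy, H2 | ring].
Qed.

Lemma complex_derivative_continuous F z g : complex_derivative F z g -> continuous F z.
Proof.
intros H; apply complex_derivative_gradient in H; destruct H as [H1 H2].
apply continuous_C; split; eapply has_gradient_continuous; eauto.
Qed.

Lemma holomorphic_complex_derivative (D : C -> Prop) F z :
  open D -> holomorphic D F -> D z -> complex_derivative F z (dz F z).
Proof.
intros HD HF Hz; apply complex_derivative_gradient.
destruct (wirtinger_holomorphic D F z HF Hz) as [H1 [H2 [H3 H4]]].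
destruct HF as [[Sr Si] _].
pose proof (smooth_has_gradient D _ z HD Sr Hz) as Gr.
pose proof (smooth_has_gradient D _ z HD Si Hz) as Gi.
rewrite (is_pdx_unique _ _ _ H1), (is_pdy_unique _ _ _ H3) in Gr.
rewrite (is_pdx_unique _ _ _ H2), (is_pdy_unique _ _ _ H4) in Gi.
simpl in Gr, Gi; rewrite Rplus_0_r, Rminus_0_l in Gr; rewrite Rplus_0_r, Rminus_0_r in Gi.
now split.
Qed.

(** Divide F z - F z1 - g (z - z1) = o(z - z1) by g, and use that z - z1 is of
    the order of w - w1. *)
Lemma complex_derivative_inverse F chi w1 (g : C) (D' : C -> Prop) K :
  open D' -> D' w1 -> g <> 0 -> 0 <= K ->
  (forall w, D' w -> F (chi w) = w) ->
  (forall w, D' w -> supnorm (chi w - chi w1) <= K * supnorm (w - w1)) ->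
  complex_derivative F (chi w1) g -> complex_derivative chi w1 (/ g).
Proof.
intros HD' Hw1 Ng HK HF HL HFd eps He.
set (N := supnorm (/ g)).
assert (HN : 0 <= N) by apply supnorm_pos.
assert (HM : 0 < 2 * N * K + 1) by nra.
(* Dividing by g costs a factor 2 N, and passing from z - z1 to w - w1 a factor K. *)
destruct (HFd (eps / (2 * N * K + 1))) as [d [Hd Kd]]; [apply Rdiv_lt_0_compat; lra|].
destruct (open_contains_square D' w1 HD' Hw1) as [r [Hr Hsq]].
exists (Rmin r (d / (K + 1))); split.
{ apply Rmin_pos; auto; apply Rdiv_lt_0_compat; lra. }
intros w Hw.
assert (Dw : D' w).
{ apply Hsq, square_supnorm; eapply Rlt_le_trans; [exact Hw | apply Rmin_l]. }
assert (Hw2 : supnorm (w - w1) < d / (K + 1)).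
{ eapply Rlt_le_trans; [exact Hw | apply Rmin_r]. }
pose proof (HL w Dw) as L; pose proof (supnorm_pos (w - w1)) as P.
assert (Hc : supnorm (chi w - chi w1) < d).
{ apply (Rmult_lt_compat_r (K + 1)) in Hw2; [|lra].
  unfold Rdiv in Hw2; rewrite Rmult_assoc, Rinv_l in Hw2 by lra; nra. }
specialize (Kd (chi w) Hc); rewrite (HF w Dw), (HF w1 Hw1) in Kd.
replace (chi w - chi w1 - / g * (w - w1))%C
  with (- (/ g * (w - w1 - g * (chi w - chi w1))))%C by (field; auto).
rewrite supnorm_opp; eapply Rle_trans; [apply supnorm_mult|]; fold N.
set (e' := eps / (2 * N * K + 1)) in *.
assert (Ee : e' * (2 * N * K + 1) = eps) by (unfold e'; field; lra).
assert (He' : 0 < e') by (apply Rdiv_lt_0_compat; lra).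
apply Rle_trans with (2 * N * (e' * (K * supnorm (w - w1)))).
- apply Rmult_le_compat_l; [lra|]; eapply Rle_trans; [exact Kd|].
  apply Rmult_le_compat_l; lra.
- rewrite <- Ee; replace (2 * N * (e' * (K * supnorm (w - w1))))
    with (e' * (2 * N * K) * supnorm (w - w1)) by ring.
  apply Rmult_le_compat_r; auto; nra.
Qed.

(** Solving F z = w amounts to finding a fixed point of z - (F z - w) / g z0,
    whose derivative 1 - g z / g z0 is small near z0. The contraction also
    gives that the solution is Lipschitz in w. *)
Lemma holomorphic_local_inverse z0 r (F g : C -> C) : 0 < r ->
  holomorphic (square z0 r) g -> (forall z, square z0 r z -> wirtinger F z (g z) 0) ->
  (forall z, square z0 r z -> g z <> 0) ->
  exists (D' : C -> Prop) (chi : C -> C),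
    open D' /\ D' (F z0) /\ chi (F z0) = z0 /\
    forall w, D' w -> square z0 r (chi w) /\ F (chi w) = w /\
      complex_derivative chi w (/ g (chi w))%C.
Proof.
intros Hr Hg HF Ng.
pose proof (square_open z0 r) as HO.
assert (Hz0 : square z0 r z0) by (split; rewrite Rminus_diag, Rabs_R0; auto).
set (k := (/ g z0)%C).
(* The derivative of the contracting map G; it vanishes at z0. *)
set (h := fun z => (1 - k * g z)%C).
assert (Sh : smoothC (square z0 r) h).
{ apply smoothC_minus; auto using smoothC_const; apply smoothC_mult; auto using smoothC_const; apply Hg. }
set (G := fun z => (z - k * F z)%C).
assert (WG : forall z, square z0 r z -> wirtinger G z (h z) 0).
{ intros z Hz; eapply wirtinger_eq; [apply (wirtinger_minus _ _ _ _ _ _ _ (wirtinger_id z)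
    (wirtinger_mult _ _ _ _ _ _ _ (wirtinger_const k z) (HF z Hz)))| |];
    unfold h; ring. }
assert (Hrho : exists rho, 0 < rho /\ forall z, square z0 rho z ->
  square z0 r z /\ Rabs (Re (h z)) <= / 4 /\ Rabs (Im (h z)) <= / 4).
{ destruct (open_contains_square (fun z => (square z0 r z /\ 0 < / 4 - Rabs (Re (h z)))
      /\ 0 < / 4 - Rabs (Im (h z))) z0) as [rho [Hp Hsq]].
  - assert (Cn : forall u : C -> R, smooth (square z0 r) u -> forall z, square z0 r z ->
      continuous (fun z => / 4 - Rabs (u z)) z).
    { intros u Hu z Hz.
      apply (continuous_minus (fun _ => / 4) (fun z => Rabs (u z))); [apply continuous_const|].
      apply (continuous_comp u Rabs); [now apply smooth_continuous with (square z0 r)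
        | apply continuous_Rabs]. }
    apply open_positive; [apply open_positive; auto|]; intros z Hz; apply Cn; try apply Sh; auto.
    apply Hz.
  - assert (E : h z0 = 0) by (unfold h, k; rewrite Cinv_l by auto; ring).
    rewrite E; simpl; rewrite Rabs_R0; repeat split; try apply Hz0; lra.
  - exists rho; split; auto; intros z Hz; destruct (Hsq z Hz) as [[H1 H2] H3].
    split; [exact H1 | lra]. }
destruct Hrho as [rho [Hrho Hsq]].
assert (Contr : forall z z', square z0 rho z -> square z0 rho z' ->
  supnorm (G z - G z') <= / 2 * supnorm (z - z')).
(* The bound 1/4 on the partial derivatives doubles in the mean value estimate. *)
{ intros z z' Hz Hz'; replace (/ 2) with (2 * / 4) by lra.
  apply supnorm_le; split.
  - apply (mean_value_square z0 rho (fun z => Re (G z)) (fun z => Re (h z)) (fun z => - Im (h z))); auto.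
    + intros w Hw; destruct (WG w (proj1 (Hsq w Hw))) as [H1 [H2 [H3 H4]]]; simpl in *; split.
      * eapply is_pdx_eq; [exact H1 | ring].
      * eapply is_pdy_eq; [exact H3 | ring].
    + intros w Hw; rewrite Rabs_Ropp; now apply Hsq.
  - apply (mean_value_square z0 rho (fun z => Im (G z)) (fun z => Im (h z)) (fun z => Re (h z))); auto.
    + intros w Hw; destruct (WG w (proj1 (Hsq w Hw))) as [H1 [H2 [H3 H4]]]; simpl in *; split.
      * eapply is_pdx_eq; [exact H2 | ring].
      * eapply is_pdy_eq; [exact H4 | ring].
    + intros w Hw; split; now apply Hsq. }
set (N := supnorm k); assert (HN : 0 <= N) by apply supnorm_pos.
assert (Nk : k <> 0).
{ unfold k; intros E; assert (E1 : (/ g z0 * g z0 = 1)%C) by (apply Cinv_l; auto).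
  rewrite E, Cmult_0_l in E1; injection E1; lra. }
(* The first step of the iteration is k (w - F z0), of norm at most
   2 N delta; it must not exceed half of rho / 2. *)
set (delta := rho / (8 * (N + 1))).
assert (Hdelta : 0 < delta) by (apply Rdiv_lt_0_compat; lra).
assert (Cl : forall z, supnorm (z - z0) <= rho / 2 -> square z0 rho z).
{ intros z Hz; apply square_supnorm; lra. }
assert (Ex : forall w, square (F z0) delta w ->
  exists z, supnorm (z - z0) <= rho / 2 /\ F z = w).
{ intros w Hw; apply square_supnorm in Hw.
  destruct (contraction_fixed_point (fun z => (G z + k * w)%C) z0 (rho / 2)) as [z [Hz Ez]].
  - intros z z' Hz Hz'.
    replace (G z + k * w - (G z' + k * w))%C with (G z - G z')%C by ring; auto.
  - replace (G z0 + k * w - z0)%C with (k * (w - F z0))%C by (unfold G; ring).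
    eapply Rle_trans; [apply supnorm_mult|]; fold N.
    apply Rle_trans with (2 * N * delta); [apply Rmult_le_compat_l; lra|].
    assert (Ed : delta * (8 * (N + 1)) = rho) by (unfold delta; field; lra).
    nra.
  - exists z; split; auto; unfold G in Ez.
    transitivity (w - / k * (z - k * F z + k * w - z))%C; [field; auto|].
    rewrite Ez; ring. }
set (chi := fun w => epsilon (inhabits z0) (fun z => supnorm (z - z0) <= rho / 2 /\ F z = w)).
assert (Hchi : forall w, square (F z0) delta w ->
  supnorm (chi w - z0) <= rho / 2 /\ F (chi w) = w).
{ intros w Hw; apply (epsilon_spec (inhabits z0)); auto. }
clearbody chi.
assert (Dw0 : square (F z0) delta (F z0)) by (split; rewrite Rminus_diag, Rabs_R0; auto).
assert (Lip : forall w w', square (F z0) delta w -> square (F z0) delta w' ->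
  supnorm (chi w - chi w') <= 4 * N * supnorm (w - w')).
{ intros w w' Hw Hw'; destruct (Hchi w Hw) as [H1 H2], (Hchi w' Hw') as [H3 H4].
  pose proof (Contr (chi w) (chi w') (Cl _ H1) (Cl _ H3)) as K.
  assert (supnorm (chi w - chi w') <= / 2 * supnorm (chi w - chi w') + 2 * N * supnorm (w - w')).
  { replace (chi w - chi w')%C with (G (chi w) - G (chi w') + k * (w - w'))%C at 1
      by (unfold G; rewrite H2, H4; ring).
    eapply Rle_trans; [apply supnorm_plus|].
    apply Rplus_le_compat; [exact K | apply supnorm_mult]. }
  lra. }
exists (square (F z0) delta), chi.
split; [apply square_open|]; split; [exact Dw0|]; split.
- destruct (Hchi _ Dw0) as [H1 H2].
  assert (Z : square z0 rho z0) by (split; rewrite Rminus_diag, Rabs_R0; auto).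
  pose proof (Contr _ _ (Cl _ H1) Z) as K.
  replace (G (chi (F z0)) - G z0)%C with (chi (F z0) - z0)%C in K
    by (unfold G; rewrite H2; ring).
  pose proof (supnorm_pos (chi (F z0) - z0)).
  assert (E : (chi (F z0) - z0)%C = 0) by (apply supnorm_eq_0; lra).
  transitivity (chi (F z0) - z0 + z0)%C; [ring | rewrite E; ring].
- intros w Hw; destruct (Hchi w Hw) as [H1 H2].
  pose proof (proj1 (Hsq _ (Cl _ H1))) as Hs.
  split; [exact Hs|]; split; [exact H2|].
  apply complex_derivative_inverse with F (square (F z0) delta) (4 * N); auto.
  + apply square_open.
  + lra.
  + intros w' Hw'; now apply Hchi.
  + rewrite <- (wirtinger_dz _ _ _ _ (HF _ Hs)).
    apply holomorphic_complex_derivative with (square z0 r); auto.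
    apply holomorphic_intro with g; auto; apply Hg.
Qed.

Lemma holomorphic_inv (D : C -> Prop) (g : C -> C) : open D -> holomorphic D g ->
  (forall z, D z -> g z <> 0) -> holomorphic D (fun z => (/ g z)%C).
Proof.
intros HD Hg N.
assert (Sg : smoothC D (fun z => (/ g z)%C)) by (apply smoothC_inv; auto; apply Hg).
split; auto; intros z Hz.
pose proof (wirtinger_dzbar _ _ _ _ (wirtinger_mult _ _ _ _ _ _ _
  (wirtinger_smooth D _ z Sg Hz) (wirtinger_holomorphic D g z Hg Hz))) as E.
rewrite (dzbar_ext D _ (fun _ => RtoC 1) z HD Hz) in E
  by (intros; apply Cinv_l; auto).
rewrite (wirtinger_dzbar _ _ _ _ (wirtinger_const 1 z)) in E.
specialize (N z Hz); set (d := dzbar _ z) in *.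
transitivity (/ g z * (d * g z + / g z * 0))%C; [field; auto | rewrite <- E; ring].
Qed.

Lemma holomorphic_mult (D : C -> Prop) g h : open D -> holomorphic D g -> holomorphic D h ->
  holomorphic D (fun z => (g z * h z)%C).
Proof.
intros HD Hg Hh; split; [apply smoothC_mult; auto; (apply Hg || apply Hh)|].
intros z Hz; rewrite (wirtinger_dzbar _ _ _ _ (wirtinger_mult _ _ _ _ _ _ _
  (wirtinger_holomorphic D g z Hg Hz) (wirtinger_holomorphic D h z Hh Hz))); ring.
Qed.

Lemma holomorphic_subset (D D' : C -> Prop) g :
  (forall w, D' w -> D w) -> holomorphic D g -> holomorphic D' g.
Proof. intros E [H1 H2]; split; auto; now apply smoothC_subset with D. Qed.

(** Each class Ck of chi gives class Ck of g(chi) = chi', hence class C(k+1)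
    of chi. *)
Lemma holomorphic_ode_smooth (D D' : C -> Prop) g chi :
  open D -> open D' -> smoothC D g -> (forall w, D' w -> D (chi w)) ->
  (forall w, D' w -> complex_derivative chi w (g (chi w))) -> smoothC D' chi.
Proof.
intros HD HD' [Gr Gi] M Hd.
assert (W : forall w, D' w -> wirtinger chi w (g (chi w)) 0).
{ intros w Hw; now apply complex_derivative_wirtinger, Hd. }
assert (K : forall n, Ck n D' (fun w => Re (chi w)) /\ Ck n D' (fun w => Im (chi w))).
{ induction n as [|n [Cr Cm]].
  - split; intros w Hw; apply continuous_C;
      now apply complex_derivative_continuous with (g (chi w)), Hd.
  - pose proof (Ck_comp n D D' (fun z => Re (g z)) chi HD HD' M (Gr n) Cr Cm) as K1.
    pose proof (Ck_comp n D D' (fun z => Im (g z)) chi HD HD' M (Gi n) Cr Cm) as K2.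
    split.
    + apply Ck_S_intro with (fun w => Re (g (chi w))) (fun w => - Im (g (chi w)));
        auto using Ck_opp; intros w Hw; destruct (W w Hw) as [H1 [H2 [H3 H4]]]; simpl in *.
      * eapply is_pdx_eq; [exact H1 | ring].
      * eapply is_pdy_eq; [exact H3 | ring].
    + apply Ck_S_intro with (fun w => Im (g (chi w))) (fun w => Re (g (chi w)));
        auto; intros w Hw; destruct (W w Hw) as [H1 [H2 [H3 H4]]]; simpl in *.
      * eapply is_pdx_eq; [exact H2 | ring].
      * eapply is_pdy_eq; [exact H4 | ring]. }
split; intros n; apply K.
Qed.

(** * The normalized parameter *)

(** The spinors are multiplied by a square root l of chi' (by its conjugate in
    the case of psi2), so that the components of the derivative of f,
    quadratic in the spinors, are multiplied by chi'. *)
Section Reparametrization.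

Context {D D' : C -> Prop} {f : C -> Nil} {psi1 psi2 chi l : C -> C}.
Context (HD : open D) (HD' : open D') (W : weierstrass D f psi1 psi2)
  (Hm : forall w, D' w -> D (chi w)) (Hchi : holomorphic D' chi)
  (Hl : holomorphic D' l) (Hll : forall w, D' w -> (l w * l w = dz chi w)%C)
  (Nl : forall w, D' w -> l w <> 0).

Let phi1 := fun w => (psi1 (chi w) * l w)%C.
Let phi2 := fun w => (psi2 (chi w) * Cconj (l w))%C.

Lemma dz_chi_neq_0 w : D' w -> dz chi w <> 0.
Proof.
intros Hw; rewrite <- (Hll w Hw).
specialize (Nl w Hw); intros E; now apply (Cmult_neq_0 (l w) (l w)).
Qed.

Lemma wirtinger_phi1 w : D' w -> wirtinger phi1 w
  (dz psi1 (chi w) * dz chi w * l w + psi1 (chi w) * dz l w)%C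
  (dzbar psi1 (chi w) * Cconj (dz chi w) * l w)%C.
Proof.
intros Hw; eapply wirtinger_eq; [apply (wirtinger_mult _ _ w _ _ _ _
  (wirtinger_comp_holo D psi1 chi w _ HD (w_smooth1 _ _ _ _ W) (Hm w Hw)
    (wirtinger_holomorphic D' chi w Hchi Hw))
  (wirtinger_holomorphic D' l w Hl Hw))| |]; ring.
Qed.

Lemma wirtinger_phi2 w : D' w -> wirtinger phi2 w
  (dz psi2 (chi w) * dz chi w * Cconj (l w))%C
  (dzbar psi2 (chi w) * Cconj (dz chi w) * Cconj (l w) + psi2 (chi w) * Cconj (dz l w))%C.
Proof.
intros Hw; eapply wirtinger_eq; [apply (wirtinger_mult _ _ w _ _ _ _
  (wirtinger_comp_holo D psi2 chi w _ HD (w_smooth2 _ _ _ _ W) (Hm w Hw)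
    (wirtinger_holomorphic D' chi w Hchi Hw))
  (wirtinger_conj _ _ _ _ (wirtinger_holomorphic D' l w Hl Hw)))| |].
- replace (Cconj 0) with (RtoC 0) by (apply injective_projections; simpl; ring); ring.
- ring.
Qed.

Lemma mean_curvature_reparam w : D' w ->
  mean_curvature (fun w => f (chi w)) w = mean_curvature f (chi w).
Proof.
intros Hw; apply mean_curvature_comp with D D'; auto; try apply W.
now apply dz_chi_neq_0.
Qed.

Lemma potential_reparam w : D' w ->
  potential (fun w => f (chi w)) phi1 phi2 w
  = (potential f psi1 psi2 (chi w) * (l w * Cconj (l w)))%C.
Proof.
intros Hw; unfold potential; rewrite mean_curvature_reparam by auto.
unfold phi1, phi2; rewrite !Cmod_mult, Cmod_conj, !Rpow_mult_distr, <- Cmod2_conj.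
generalize (Cmod (psi1 (chi w)) ^ 2) (Cmod (psi2 (chi w)) ^ 2) (Cmod (l w) ^ 2)
  (mean_curvature f (chi w)); intros.
apply injective_projections; simpl; field.
Qed.

Lemma conformal_reparam : conformal D' (fun w => f (chi w)).
Proof.
apply conformal_mc; [apply (smoothNil_comp HD HD' Hm); auto; apply W|].
intros w Hw.
rewrite (mcx_comp HD Hm (w_smooth _ _ _ _ W) Hchi w Hw).
rewrite (mcy_comp HD Hm (w_smooth _ _ _ _ W) Hchi w Hw).
destruct (proj1 (conformal_mc D f (w_smooth _ _ _ _ W)) (w_conformal _ _ _ _ W) (chi w) (Hm w Hw))
  as [H1 [H2 H3]].
pose proof (C_neq_0_norm2 _ (dz_chi_neq_0 w Hw)).
rewrite !dot_lin, H2, <- H1; repeat split; try ring; nra.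
Qed.

Lemma mcz_reparam w : D' w ->
  mcz (fun w => f (chi w)) w
  = (dz chi w * fst (fst (mcz f (chi w))), dz chi w * snd (fst (mcz f (chi w))),
     dz chi w * snd (mcz f (chi w)))%C.
Proof.
intros Hw; unfold mcz.
rewrite (mcx_comp HD Hm (w_smooth _ _ _ _ W) Hchi w Hw).
rewrite (mcy_comp HD Hm (w_smooth _ _ _ _ W) Hchi w Hw).
generalize (mcx f (chi w)) (mcy f (chi w)) (dz chi w); intros X Y d.
unfold lin, v1, v2, v3; simpl.
f_equal; [f_equal|]; apply injective_projections; simpl; unfold Re, Im; field.
Qed.

Lemma weierstrass_reparam : weierstrass D' (fun w => f (chi w)) phi1 phi2.
Proof.
assert (Ec : forall c : C, Cconj (Cconj c) = c) by apply Cconj_conj.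
split.
- apply (smoothNil_comp HD HD' Hm); auto; apply W.
- apply smoothC_mult; auto; [|apply Hl].
  apply (smoothC_comp D D'); auto; [apply W | apply Hchi].
- apply smoothC_mult; auto; [|apply smoothC_conj; auto; apply Hl].
  apply (smoothC_comp D D'); auto; [apply W | apply Hchi].
- apply conformal_reparam.
- intros w Hw; cbv zeta; rewrite mcz_reparam by auto.
  rewrite (w_repr _ _ _ _ W (chi w) (Hm w Hw)); cbv zeta; simpl fst; simpl snd.
  unfold phi1, phi2; rewrite Cmult_conj, Ec, <- (Hll w Hw).
  f_equal; [f_equal|]; unfold Cdiv; ring.
- intros w Hw; rewrite potential_reparam by auto.
  rewrite (wirtinger_dz _ _ _ _ (wirtinger_phi2 w Hw)), <- (Hll w Hw).
  transitivity ((dz psi2 (chi w) + potential f psi1 psi2 (chi w) * psi1 (chi w))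
     * (l w * l w * Cconj (l w)))%C; [unfold phi1; ring|].
  rewrite (w_dirac1 _ _ _ _ W) by auto; ring.
- intros w Hw; rewrite potential_reparam by auto.
  rewrite (wirtinger_dzbar _ _ _ _ (wirtinger_phi1 w Hw)), <- (Hll w Hw), Cmult_conj.
  transitivity ((- dzbar psi1 (chi w) + potential f psi1 psi2 (chi w) * psi2 (chi w))
     * (l w * Cconj (l w) * Cconj (l w)))%C; [unfold phi2; ring|].
  rewrite (w_dirac2 _ _ _ _ W) by auto; ring.
Qed.

(** The derivative of l cancels between the two terms, which leaves the factor
    l^2 chi' = chi'^2. *)
Lemma wronskian_reparam w : D' w ->
  spin_wronskian phi1 (fun w => Cconj (phi2 w)) w
  = (spin_wronskian psi1 (fun w => Cconj (psi2 w)) (chi w) * (dz chi w * dz chi w))%C.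
Proof.
intros Hw; unfold spin_wronskian.
rewrite (wirtinger_dz _ _ _ _ (wirtinger_phi1 w Hw)).
rewrite (wirtinger_dz _ _ _ _ (wirtinger_conj _ _ _ _ (wirtinger_phi2 w Hw))).
rewrite (wirtinger_dz _ _ _ _ (wirtinger_conj _ _ _ _
  (wirtinger_smooth D psi2 (chi w) (w_smooth2 _ _ _ _ W) (Hm w Hw)))).
unfold phi1, phi2; rewrite Cplus_conj, !Cmult_conj, !Cconj_conj, <- (Hll w Hw); ring.
Qed.

End Reparametrization.

(** The spinor factor is l = 1 / s(chi), and chi solves chi' = 1 / t(chi),
    where s^2 = t and t^2 = A / (4i). *)
Lemma normalized_parameter_exists (D : C -> Prop) f psi1 psi2 z0 :
  open D -> weierstrass D f psi1 psi2 -> minimal D f -> D z0 ->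
  ~ umbilic f psi1 psi2 z0 ->
  exists (D' : C -> Prop) (chi phi1 phi2 : C -> C),
    normalized_parameter D f z0 D' chi phi1 phi2.
Proof.
intros HD W M Hz0 Hnu.
pose proof (weierstrass_minimal_spinors D f psi1 psi2 HD W M) as Hs.
set (A := spin_wronskian psi1 (fun w => Cconj (psi2 w))).
assert (HA : holomorphic D A).
{ split; [now apply (wronskian_smooth HD Hs) | intros z Hz; now apply (wronskian_holomorphic HD Hs)]. }
assert (NA : A z0 <> 0).
{ intros E; apply Hnu; unfold umbilic; rewrite Atilde_minimal; auto. }
assert (NC : Ci <> 0) by (intros E; injection E; lra).
assert (Hmm : holomorphic D (fun z => (/ (4 * Ci) * A z)%C)).
{ apply holomorphic_mult; auto; split; [now apply smoothC_const|].
  intros z Hz; apply (wirtinger_dzbar _ _ _ _ (wirtinger_const _ z)). }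
destruct (local_holomorphic_sqrt D _ z0 HD Hmm Hz0) as [D0 [t [HD0 [D0z [D0D [Ht Et]]]]]].
{ intros E; cbv beta in E; apply NA; transitivity (4 * Ci * (/ (4 * Ci) * A z0))%C; [field; auto|].
  rewrite E; ring. }
cbv beta in Et.
destruct (local_holomorphic_sqrt D0 t z0 HD0 Ht D0z) as [D1 [s [HD1 [D1z [D1D [Hss Es]]]]]].
{ now apply Et. }
destruct (open_contains_square D1 z0 HD1 D1z) as [r [Hr Hsq]].
pose proof (square_open z0 r) as HQ.
assert (HtQ : holomorphic (square z0 r) t) by (apply holomorphic_subset with D0; auto).
assert (HsQ : holomorphic (square z0 r) s) by (apply holomorphic_subset with D1; auto).
assert (Nt : forall z, square z0 r z -> t z <> 0) by (intros z Hz; apply Et; auto).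
assert (Ns : forall z, square z0 r z -> s z <> 0) by (intros z Hz; apply Es; auto).
destruct (holomorphic_primitive z0 r t HtQ) as [F HF].
destruct (holomorphic_local_inverse z0 r F t Hr HtQ HF Nt)
  as [D' [chi [HD' [Dw0 [E0 Hchi]]]]].
assert (Sit := holomorphic_inv _ _ HQ HtQ Nt).
assert (Sis := holomorphic_inv _ _ HQ HsQ Ns).
assert (Wchi : forall w, D' w -> wirtinger chi w (/ t (chi w))%C 0).
{ intros w Hw; now apply complex_derivative_wirtinger, Hchi. }
assert (Hol : holomorphic D' chi).
{ split.
  - apply (holomorphic_ode_smooth (square z0 r) D' (fun z => (/ t z)%C)); auto;
      try apply Sit; intros w Hw; now apply Hchi.
  - intros w Hw; eapply wirtinger_dzbar; auto. }
assert (Hm : forall w, D' w -> D (chi w)) by (intros w Hw; apply D0D, D1D, Hsq, Hchi; auto).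
set (l := fun w => (/ s (chi w))%C).
assert (Hl : holomorphic D' l).
{ split.
  - apply (smoothC_comp (square z0 r) D' (fun z => (/ s z)%C)); auto;
      [intros w Hw; now apply Hchi | apply Sis | apply Hol].
  - intros w Hw; destruct (Hchi w Hw) as [Hq _].
    unfold l; rewrite (wirtinger_dzbar _ _ _ _ (wirtinger_comp_holo (square z0 r) (fun z => (/ s z)%C) chi w _
      HQ (proj1 Sis) Hq (Wchi w Hw))).
    rewrite (proj2 Sis) by auto; ring. }
assert (Hll : forall w, D' w -> (l w * l w = dz chi w)%C).
{ intros w Hw; destruct (Hchi w Hw) as [Hq _].
  rewrite (wirtinger_dz _ _ _ _ (Wchi w Hw)); unfold l.
  rewrite <- (proj1 (Es (chi w) (Hsq _ Hq))); field; now apply Ns. }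
assert (Nl : forall w, D' w -> l w <> 0).
{ intros w Hw E; destruct (Hchi w Hw) as [Hq _].
  assert (s (chi w) * l w = 1)%C as E1 by (unfold l; apply Cinv_r, Ns; auto).
  rewrite E, Cmult_0_r in E1; injection E1; lra. }
exists D', chi, (fun w => (psi1 (chi w) * l w)%C), (fun w => (psi2 (chi w) * Cconj (l w))%C).
split.
- split; auto; try apply Hol.
  + intros w Hw; now apply (dz_chi_neq_0 Hll Nl).
  + intros w w' Hw Hw' E.
    rewrite <- (proj1 (proj2 (Hchi w Hw))), <- (proj1 (proj2 (Hchi w' Hw'))); now rewrite E.
  + now exists (F z0).
- now apply (weierstrass_reparam HD HD' W Hm Hol Hl Hll Nl).
- intros w Hw; cbv zeta.
  assert (H0 : mean_curvature (fun w => f (chi w)) w = 0).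
  { rewrite (mean_curvature_reparam HD HD' W Hm Hol Hll Nl w Hw); apply M; auto. }
  unfold ARcoef; rewrite Atilde_minimal, H0 by auto.
  rewrite (wronskian_reparam HD W Hm Hol Hl Hll w Hw); fold A.
  destruct (Hchi w Hw) as [Hq _].
  rewrite (wirtinger_dz _ _ _ _ (Wchi w Hw)).
  replace (A (chi w)) with (4 * Ci * (t (chi w) * t (chi w)))%C.
  + transitivity (/ 4 * (2 * 0 + Ci) * (4 * Ci))%C; [field; now apply Nt|].
    apply injective_projections; simpl; field.
  + rewrite (proj1 (Et (chi w) (D1D _ (Hsq _ Hq)))); field; auto.
Qed.

Theorem theorem2 (S : C -> Prop) (f : C -> Nil) (psi1 psi2 : C -> C) (z0 : C)
    (hS : open S) (hW : weierstrass S f psi1 psi2) (hmin : minimal S f)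
    (hz0 : S z0) (hnu : ~ umbilic f psi1 psi2 z0) :
  (exists (S' : C -> Prop) (chi phi1 phi2 : C -> C),
     normalized_parameter S f z0 S' chi phi1 phi2) /\
  (forall (S' : C -> Prop) (chi phi1 phi2 : C -> C),
     normalized_parameter S f z0 S' chi phi1 phi2 ->
     let U := potential (fun w => f (chi w)) phi1 phi2 in
     (forall w0 : C, S' w0 -> chi w0 = z0 -> U w0 <> 0%C ->
        exists (V : C -> Prop) (v : C -> C),
          open V /\ V w0 /\ (forall w, V w -> S' w) /\ continuous_log V v U) /\
     (forall (V : C -> Prop) (v : C -> C),
        open V -> (forall w, V w -> S' w) -> continuous_log V v U ->
        solves_system V v)).
Proof.
split; [now apply normalized_parameter_exists with psi1 psi2|].
intros S' chi phi1 phi2 [Hcc W' HB] U.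
destruct Hcc as [HS' Hm Hsm Hh Hi _ _].
set (F := fun w => f (chi w)) in *.
set (u := spin_potential phi1 (fun w => Cconj (phi2 w))).
assert (H0 : minimal S' F).
{ intros w Hw; unfold F; rewrite (mean_curvature_comp S S' f chi w); auto; try apply hW.
  now split. }
pose proof (weierstrass_minimal_spinors S' F phi1 phi2 HS' W' H0) as Hs.
assert (EU : forall w, S' w -> U w = u w) by (intros w Hw; now apply potential_minimal, H0).
split.
- intros w0 Hw0 _ Hnz; rewrite (EU w0 Hw0) in Hnz.
  destruct (continuous_log_exists S' u w0) as [V [v [HV [Vw [HVS Hv]]]]]; auto.
  + intros w Hw; apply smoothC_continuous with S'; auto; now apply (spin_potential_smooth HS' Hs).
  + intros w Hw; unfold u; now rewrite spin_potential_pair.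
  + exists V, v; repeat split; auto; [now apply Hv|].
    rewrite EU by auto; now apply Hv.
- intros V v HV HVS Hv.
  apply log_solves with S' phi1 (fun w => Cconj (phi2 w)); auto.
  + intros w Hw; pose proof (HB w Hw) as E; cbv zeta in E.
    unfold ARcoef in E; rewrite Atilde_minimal, (H0 w Hw) in E by auto.
    set (h := spin_wronskian _ _ w) in *.
    transitivity (4 * / Ci * (/ 4 * (2 * 0 + Ci) * h))%C.
    * field; intros E'; injection E'; lra.
    * rewrite E; apply injective_projections; simpl; field.
  + intros w Hw; split; [now apply Hv|]; fold u; rewrite <- EU by auto; now apply Hv.
Qed.
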